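(* Let $\beta=1$. There are constants $C_1,C_2>0$ such that, for the Glauber dynamics for the Ising model on the complete graph $K_n$ with parameter $\beta=1$, $$C_1 n^{3/2}\le t_{\rm mix}(n)\le C_2 n^{3/2}\qquad\text{for all } n.$$
   Context: For an integer $n\ge1$ let $\Omega_n=\{-1,1\}^n$. The Ising (Curie-Weiss) measure on $K_n$ with parameter $\beta\ge0$ is the probability measure $\mu_n$ on $\Omega_n$ given by $\mu_n(\sigma)=\frac1{Z(\beta)}\exp\big(\frac{\beta}{n}\sum_{1\le i<j\le n}\sigma(i)\sigma(j)\big)$, with $Z(\beta)$ the normalizing constant. For $\sigma\in\Omega_n$ let $S(\sigma)=\frac1n\sum_{i=1}^n\sigma(i)$, and let $p_+(s)=\frac{1+\tanh(\beta s)}2$. The Glauber dynamics is the Markov chain $(X^n_t)_{t\ge0}$ on $\Omega_n$ which, when at $\sigma$, chooses a site $i\in\{1,\dots,n\}$ uniformly at random and replaces the spin at $i$ by $+1$ with probability $p_+(S(\sigma)-\sigma(i)/n)$ and by $-1$ otherwise, leaving all other spins unchanged. It is reversible with respect to $\mu_n$. $\mathbf P_\sigma$ denotes its law when started at $\sigma$. Set $d_n(t)=\max_{\sigma\in\Omega_n}\|\mathbf P_\sigma(X^n_t\in\cdot)-\mu_n\|_{\rm TV}$ (total variation distance) and $t_{\rm mix}(n)=\min\{t: d_n(t)\le 1/4\}$. *)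

(* Defs.v *)
(* MathComp + MathComp-Analysis: the reals are an arbitrary [R : realType]. *)
From HB Require Import structures.
From mathcomp Require Import all_boot all_order all_algebra.
From mathcomp Require Import reals sequences exp.
Set Implicit Arguments.
Unset Strict Implicit.
Unset Printing Implicit Defensive.
Import Order.TTheory GRing.Theory Num.Theory.
Local Open Scope ring_scope.

(* A spin is a bit: [true] stands for +1 and [false] for -1, see [spin]. *)
Definition config (n : nat) : finType := {ffun 'I_n -> bool}.

Definition spin (R : realType) (n : nat) (s : config n) (i : 'I_n) : R :=
  if s i then 1 else -1.

Definition set_spin (n : nat) (s : config n) (i : 'I_n) (b : bool) : config n :=
  [ffun j => if j == i then b else s j].

Definition gibbs_weight (R : realType) (beta : R) (n : nat) (s : config n) : R :=
  expR (beta / n%:R *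
        \sum_(i < n) \sum_(j < n | (i < j)%N) spin R s i * spin R s j).

Definition partition_function (R : realType) (beta : R) (n : nat) : R :=
  \sum_(s : config n) gibbs_weight beta s.

Definition ising (R : realType) (beta : R) (n : nat) (s : config n) : R :=
  gibbs_weight beta s / partition_function beta n.

Definition magnetization (R : realType) (n : nat) (s : config n) : R :=
  n%:R^-1 * \sum_(i < n) spin R s i.

Definition tanh (R : realType) (x : R) : R :=
  (expR x - expR (- x)) / (expR x + expR (- x)).

Definition p_plus (R : realType) (beta s : R) : R := (1 + tanh (beta * s)) / 2.

(* The two updates at [i] may well produce [s] itself, hence the sum of
   indicators rather than a case distinction on [s']. *)
Definition glauber (R : realType) (beta : R) (n : nat) (s s' : config n) : R :=
  \sum_(i < n) n%:R^-1 *
    let p := p_plus beta (magnetization R s - spin R s i / n%:R) in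
    (p * (s' == set_spin s i true)%:R + (1 - p) * (s' == set_spin s i false)%:R).

(* [law P x t y] is the probability that the chain with transition matrix [P]
   started at [x] is at [y] at time [t]. *)
Fixpoint law (R : realType) (T : finType) (P : T -> T -> R) (x : T) (t : nat)
    (y : T) : R :=
  if t is t'.+1 then \sum_(z : T) law P x t' z * P z y else (y == x)%:R.

Definition tv_dist (R : realType) (T : finType) (mu nu : T -> R) : R :=
  \big[Num.max/0]_(A : {set T}) `|\sum_(x in A) mu x - \sum_(x in A) nu x|.

Definition mixing_distance (R : realType) (beta : R) (n t : nat) : R :=
  \big[Num.max/0]_(s : config n)
    tv_dist (law (@glauber R beta n) s t) (@ising R beta n).

(* [t] is the least element of the set of times at distance at most 1/4; that
   this set is nonempty is not built in. *)
Definition is_mixing_time (R : realType) (beta : R) (n t : nat) : Prop :=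
  mixing_distance beta n t <= 1 / 4 /\
  forall u : nat, mixing_distance beta n u <= 1 / 4 -> (t <= u)%N.

(* Main.v *)
(* The number of plus spins performs a birth-and-death chain on {0, ..., n}.
   Write s for the magnetization.

   Lower bound: the drift of s is about (tanh s - s) / n, which has the sign of
   -s and size at most |s|^3 / n, so (s - c)^2 grows by at most O(c^4 / n + n^-2)
   per step in mean.  Started from c of order n^(-1/4), the chain still has a
   plus majority with high probability after a small multiple of n^(3/2) steps,
   whereas the Ising measure gives a strict plus majority mass at most 1/2.

   Upper bound: fix a function g with values in [0, 1] and read the semigroup
   backwards.  (1) Swapping two spins commutes with the dynamics, and the
   difference it makes contracts by 1 - O(1/n) per step, so after O(n^(3/2))
   steps g is almost a function of the number of plus spins.  (2) The discrete
   gradient of the count chain is nonincreasing at beta = 1, because tanh is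
   1-Lipschitz.  Hence the variance accumulated up to time t dominates t times
   the squared gradient at time t, and the gradient is O(t^(-1/2)): it is
   O(n^(-3/4)) after O(n^(3/2)) steps.  (3) E s^2 satisfies u' <= u - u^2 / (6n)
   + O(n^-2), so |s| is O(n^(-1/4)) after n^(3/2) steps from any start, that is,
   two chains differ by O(n^(3/4)) plus spins.  With (2), what remains of the
   dependence on the starting point is small. *)
Require Import Defs.
From mathcomp Require Import all_boot all_order all_algebra.
From mathcomp Require Import reals sequences exp.
From mathcomp Require Import perm ring lra zify.
From mathcomp Require Import classical_sets interval_inference topology normedtype.
From mathcomp Require Import derive realfun.
Set Implicit Arguments.
Unset Strict Implicit.
Unset Printing Implicit Defensive.
Import Order.TTheory GRing.Theory Num.Theory.
Import numFieldTopology.Exports numFieldNormedType.Exports.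
Local Open Scope ring_scope.

(** * The hyperbolic tangent *)

Section HyperbolicTangent.
Variable R : realType.
Implicit Types x y a b : R.

Lemma is_derive_ge0_le (f df : R -> R) a b : a <= b ->
  (forall x, is_derive x 1 f (df x)) ->
  (forall x, a <= x <= b -> 0 <= df x) -> f a <= f b.
Proof.
move=> ab fdf df0.
have [|c] := MVT_segment ab (fun x _ => fdf x).
  apply: continuous_subspaceT => x.
  by apply/differentiable_continuous/derivable1_diffP; case: (fdf x).
rewrite in_itv /= => /df0 c0 e.
by rewrite -subr_ge0 e mulr_ge0 // subr_ge0.
Qed.

Lemma cosh_gt0 x : 0 < expR x + expR (- x).
Proof. by rewrite addr_gt0 ?expR_gt0. Qed.

Lemma is_derive_tanh x : is_derive x 1 (@tanh R) (1 - tanh x ^+ 2).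
Proof.
have c0 : expR x + expR (- x) != 0 by rewrite gt_eqF // cosh_gt0.
have dN : is_derive x 1 (fun y : R => expR (- y)) (- expR (- x)).
  have := @is_derive1_comp R expR -%R x _ _ (is_derive_expR (- x)) (is_deriveNid x 1).
  by rewrite mulrN1.
have dD : is_derive x 1 (fun y : R => expR y + expR (- y)) (expR x - expR (- x)).
  exact: (is_deriveD (is_derive_expR x) dN).
have dB : is_derive x 1 (fun y : R => expR y - expR (- y)) (expR x + expR (- x)).
  by have := is_deriveB (is_derive_expR x) dN; rewrite opprK.
suff <- : (expR x - expR (- x)) *:
    (- (expR x + expR (- x)) ^- 2 *: (expR x - expR (- x))) +
    (expR x + expR (- x))^-1 *: (expR x + expR (- x)) = 1 - tanh x ^+ 2.
  exact: (is_deriveM dB (is_deriveV (f := fun y => expR y + expR (- y)) c0 dD)).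
rewrite /tanh /GRing.scale /=; field.
by rewrite c0.
Qed.

Lemma tanhN x : tanh (- x) = - tanh x.
Proof. by rewrite /tanh opprK -mulNr opprB (addrC (expR x) (expR (- x))). Qed.

Lemma tanh0 : tanh 0 = 0 :> R.
Proof. by rewrite /tanh oppr0 subrr mul0r. Qed.

Lemma tanh_lt1 x : tanh x < 1.
Proof.
rewrite /tanh ltr_pdivrMr ?cosh_gt0 // mul1r.
by rewrite ltrD2l gtrN ?expR_gt0.
Qed.

Lemma tanh_gtN1 x : -1 < tanh x.
Proof. by rewrite ltrNl -tanhN tanh_lt1. Qed.

Lemma tanh_sqr_le1 x : tanh x ^+ 2 <= 1.
Proof.
rewrite -subr_ge0 -[1 in X in 0 <= X](expr1n _ 2) subr_sqr mulr_ge0 //.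
  by rewrite subr_ge0 ltW ?tanh_lt1.
by rewrite -lerBlDl sub0r ltW ?tanh_gtN1.
Qed.

Lemma tanh_le a b : a <= b -> tanh a <= tanh b.
Proof.
move=> ab; apply: (is_derive_ge0_le ab (@is_derive_tanh)) => x _.
by rewrite subr_ge0 tanh_sqr_le1.
Qed.

Lemma tanh_lipschitz a b : a <= b -> tanh b - tanh a <= b - a.
Proof.
move=> ab; suff: a - tanh a <= b - tanh b by lra.
apply: (is_derive_ge0_le (f := fun x => x - tanh x)
            (df := fun x => 1 - (1 - tanh x ^+ 2)) ab).
  by move=> x; exact: (is_deriveB (is_derive_id x 1) (is_derive_tanh x)).
by move=> x _ /=; rewrite opprB addrC subrK sqr_ge0.
Qed.

Lemma tanh_ge0 x : 0 <= x -> 0 <= tanh x.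
Proof. by rewrite -{2}tanh0; exact: tanh_le. Qed.

Lemma tanh_le_id x : 0 <= x -> tanh x <= x.
Proof. by move=> x0; have := tanh_lipschitz x0; rewrite tanh0 !subr0. Qed.

Lemma is_derive_id_sub_tanh_sub_cube c x :
  is_derive x 1 (fun y => y - tanh y - c * y ^+ 3) (tanh x ^+ 2 - c * (3 * x ^+ 2)).
Proof.
have d1 := is_deriveB (is_derive_id x 1) (is_derive_tanh x).
have d2 := is_deriveZ c (is_deriveX 3 (is_derive_id x (1 : R))).
have h := is_deriveB d1 d2.
suff <- : 1 - (1 - tanh x ^+ 2) - c *: (3 * x ^+ 2)%:A =
    tanh x ^+ 2 - c * (3 * x ^+ 2) by exact: h.
by rewrite /GRing.scale /=; ring.
Qed.

(** The derivative of [y - tanh y - y ^+ 3] is [tanh y ^+ 2 - 3 * y ^+ 2], nonpositive since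
    [tanh y <= y]. *)
Lemma id_sub_tanh_le x : 0 <= x -> x - tanh x <= x ^+ 3.
Proof.
move=> x0.
have : - (0 - tanh 0 - 1 * 0 ^+ 3) <= - (x - tanh x - 1 * x ^+ 3).
  apply: (is_derive_ge0_le (f := fun y => - (y - tanh y - 1 * y ^+ 3))
    (df := fun y => - (tanh y ^+ 2 - 1 * (3 * y ^+ 2))) x0) => y.
    exact: is_deriveN (is_derive_id_sub_tanh_sub_cube 1 y).
  move=> /andP[y0 _]; have := tanh_le_id y0; have := tanh_ge0 y0; nra.
by rewrite tanh0 expr0n /= => h; lra.
Qed.

Lemma half_le_tanh x : 0 <= x <= 1 -> x / 2 <= tanh x.
Proof.
move=> /andP[x0 x1].
have ex := expR_ge1Dx x; have en : expR x * expR (- x) = 1.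
  by rewrite -expRD subrr expR0.
have p := expR_gt0 x; have q := expR_gt0 (- x).
rewrite /tanh ler_pdivlMr ?cosh_gt0 //.
have : (1 + x) * expR (- x) <= expR x * expR (- x) by rewrite ler_pM2r.
rewrite en; move: ex p q {en}; move: (expR x) (expR (- x)) => e e' ex p q h.
(* With [e = expR x] and [e' = expR (- x)], the goal reads [e' * (1 + x / 2) <= e * (1 - x / 2)].
   Since [(1 + x) * (1 - x / 2) >= 1] on [0, 1], both sides can be separated by 1. *)
have h1 : e' <= 1 - x / 2 by nra.
have h2 : e' * (1 + x / 2) <= (1 - x / 2) * (1 + x / 2) by apply: ler_wpM2r => //; lra.
have h3 : (1 + x) * (1 - x / 2) <= e * (1 - x / 2) by apply: ler_wpM2r => //; lra.
nra.
Qed.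

(** The constant comes from [tanh y >= y / 2]: the square is at least [y ^+ 2 / 4], which is
    [3 * y ^+ 2 / 12]. *)
Lemma id_sub_tanh_ge x : 0 <= x <= 1 -> x ^+ 3 / 12 <= x - tanh x.
Proof.
move=> /andP[x0 x1].
have : 0 - tanh 0 - 12^-1 * 0 ^+ 3 <= x - tanh x - 12^-1 * x ^+ 3.
  apply: (is_derive_ge0_le (f := fun y => y - tanh y - 12^-1 * y ^+ 3)
    (df := fun y => tanh y ^+ 2 - 12^-1 * (3 * y ^+ 2)) x0) => y.
    exact: is_derive_id_sub_tanh_sub_cube.
  move=> /andP[y0 y1]; have y01 : 0 <= y <= 1 by lra.
  have := half_le_tanh y01; nra.
by rewrite tanh0 expr0n /= => h; lra.
Qed.

(** At the critical temperature the linear part of the drift vanishes; this quartic term is the only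
    restoring force on the second moment and sets the time scale n^(3/2). *)
Lemma mul_tanh_le x : `|x| <= 1 -> x * tanh x <= x ^+ 2 - x ^+ 4 / 12.
Proof.
wlog x0 : x / 0 <= x => [hw|].
  have [x0|x0] := leP 0 x; first exact: hw.
  rewrite -normrN => nx; have := hw (- x) _ nx.
  rewrite tanhN mulrNN sqrrN (_ : (- x) ^+ 4 = x ^+ 4); last by ring.
  by apply; lra.
rewrite ger0_norm // => x1; have x01 : 0 <= x <= 1 by rewrite x0.
have := id_sub_tanh_ge x01 => h.
have := ler_wpM2l x0 h; rewrite mulrBr => {}h.
have e : x * (x ^+ 3 / 12) = x ^+ 4 / 12 by ring.
by rewrite e -expr2 in h; lra.
Qed.

End HyperbolicTangent.

(** * The chain of the number of plus spins *)

Section CountChain.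
Variables (R : realType) (n : nat).
Implicit Types (f g : nat -> R) (k t : nat).

(** Here [k] counts the plus spins among the other n - 1 sites, whose field is (2k - (n - 1)) / n.
    Hence [rate_down] evaluates it at [k.-1]; for [k = 0] the factor [k%:R / n%:R] kills the default
    value. *)
Definition plus_prob k : R := p_plus 1 ((2 * k%:R + 1) / n%:R - 1).
Definition rate_up k : R := (1 - k%:R / n%:R) * plus_prob k.
Definition rate_down k : R := k%:R / n%:R * (1 - plus_prob k.-1).
Definition count_step f k : R :=
  rate_up k * f k.+1 + rate_down k * f k.-1 + (1 - rate_up k - rate_down k) * f k.

Local Notation K := count_step.

Lemma p_plus_gt0 (x : R) : 0 < p_plus 1 x.
Proof. by rewrite /p_plus mul1r; have := tanh_gtN1 x; lra. Qed.

Lemma p_plus_lt1 (x : R) : p_plus 1 x < 1.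
Proof. by rewrite /p_plus mul1r; have := tanh_lt1 x; lra. Qed.

(** By [id_sub_tanh_ge] at 1, [tanh 1 <= 11 / 12]; halving the gap to 1 gives 1/24. *)
Lemma p_plus_bounds (x : R) : -1 <= x <= 1 -> 24^-1 <= p_plus 1 x <= 1 - 24^-1.
Proof.
move=> /andP[x0 x1]; rewrite /p_plus mul1r.
have := tanh_le x0; have := tanh_le x1; rewrite tanhN.
have : 0 <= (1 : R) <= 1 by rewrite ler01 lexx.
by move=> /id_sub_tanh_ge; rewrite expr1n; move: (tanh x) (tanh 1) => a b; lra.
Qed.

Hypothesis n_gt0 : (0 < n)%N.

Let size_gt0 : 0 < n%:R :> R. Proof. by rewrite ltr0n. Qed.
Let size_inv_gt0 : 0 < n%:R^-1 :> R. Proof. by rewrite invr_gt0 size_gt0. Qed.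

Lemma plus_prob_incr k : 0 <= plus_prob k.+1 - plus_prob k <= n%:R^-1.
Proof.
rewrite /plus_prob /p_plus !mul1r.
set x := (2 * k.+1%:R + 1) / n%:R - 1; set y := (2 * k%:R + 1) / n%:R - 1.
have e : x - y = 2 * n%:R^-1 by rewrite /x /y -natr1; ring.
have yx : y <= x by rewrite -subr_ge0 e mulr_ge0 // ltW.
have := tanh_le yx; have := tanh_lipschitz yx; rewrite e.
by move: (tanh x) (tanh y) => a b; lra.
Qed.

Lemma plus_prob_bounds k : (k < n)%N -> 24^-1 <= plus_prob k <= 1 - 24^-1.
Proof.
move=> kn; apply: p_plus_bounds.
have h1 : 0 <= (2 * k%:R + 1) / n%:R :> R.
  by apply: divr_ge0 => //; rewrite addr_ge0 // mulr_ge0.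
have h2 : (2 * k%:R + 1) / n%:R <= 2 :> R.
  rewrite ler_pdivrMr // -natrM natr1 -natrM ler_nat; lia.
by move: h1 h2; lra.
Qed.

Lemma frac_itv k : (k <= n)%N -> 0 <= (k%:R / n%:R : R) <= 1.
Proof.
move=> kn; rewrite divr_ge0 //= ler_pdivrMr ?ltr0n // mul1r.
by rewrite ler_nat.
Qed.

Lemma up_ge0 k : (k <= n)%N -> 0 <= rate_up k.
Proof.
move=> /frac_itv /andP[_ h]; rewrite mulr_ge0 ?subr_ge0 //.
exact/ltW/p_plus_gt0.
Qed.

Lemma down_ge0 k : (k <= n)%N -> 0 <= rate_down k.
Proof.
move=> /frac_itv /andP[h _]; rewrite mulr_ge0 ?subr_ge0 //.
exact/ltW/p_plus_lt1.
Qed.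

Lemma up_n : rate_up n = 0.
Proof. by rewrite /rate_up divff ?subrr ?mul0r // gt_eqF. Qed.

Lemma down_0 : rate_down 0 = 0.
Proof. by rewrite /rate_down !mul0r. Qed.

(** The holding probability is a convex combination of an update probability and the complement of
    another, each at least 1/24. At [k = n] the first one has weight zero. *)
Lemma hold_ge k : (k <= n)%N -> 24^-1 <= 1 - rate_up k - rate_down k.
Proof.
move=> kn; have /andP[f0 f1] := frac_itv kn.
have -> : 1 - rate_up k - rate_down k =
    (1 - k%:R / n%:R) * (1 - plus_prob k) + k%:R / n%:R * plus_prob k.-1.
  by rewrite /rate_up /rate_down; ring.
have h1 : (1 - k%:R / n%:R) * 24^-1 <= (1 - k%:R / n%:R) * (1 - plus_prob k).
  move: kn; rewrite leq_eqVlt => /orP[/eqP ->|kn].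
    by rewrite divff ?subrr ?mul0r // gt_eqF.
  apply: ler_wpM2l; first by rewrite subr_ge0.
  by have /andP[_] := plus_prob_bounds kn; lra.
have h2 : k%:R / n%:R * 24^-1 <= k%:R / n%:R * plus_prob k.-1.
  case: k kn f0 {f1 h1} => [|k] kn f0; first by rewrite !mul0r.
  by apply: ler_wpM2l => //; have /andP[] := plus_prob_bounds kn.
lra.
Qed.

Lemma up_down_ge k : (k < n)%N -> 24^-1 <= rate_up k + rate_down k.+1 <= 1.
Proof.
move=> kn; have /andP[p0 p1] := plus_prob_bounds kn.
have /andP[f0 f1] := frac_itv (ltnW kn); have /andP[g0 g1] := frac_itv kn.
move: g0 g1; rewrite /rate_up /rate_down [k.+1.-1]/= -natr1 mulrDl mul1r => g0 g1.
move: f0 f1 g0 g1 p0 p1; move: (n%:R^-1) size_inv_gt0 (k%:R / n%:R) (plus_prob k).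
by move=> b b0 a p *; apply/andP; split; nra.
Qed.

(** These are the three weights of [grad_count_step]. The removal rate contributes -1/n; since
    [plus_prob] grows by at most 1/n per step, its increments give back at most 1/n - 1/n^2. This is
    where the 1-Lipschitz bound on tanh at beta = 1 enters. *)
Lemma drift_contraction k : (k < n)%N ->
  rate_up k.+1 + (1 - rate_up k - rate_down k.+1) + rate_down k <= 1 - n%:R^-1 ^+ 2.
Proof.
move=> kn.
have -> : rate_up k.+1 + (1 - rate_up k - rate_down k.+1) + rate_down k =
    1 - n%:R^-1 + (1 - k.+1%:R / n%:R) * (plus_prob k.+1 - plus_prob k)
    + k%:R / n%:R * (plus_prob k - plus_prob k.-1).
  by rewrite /rate_up /rate_down /= -natr1; ring.
have /andP[f0 f1] := frac_itv (ltnW kn); have /andP[g0 g1] := frac_itv kn.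
have h1 : (1 - k.+1%:R / n%:R) * (plus_prob k.+1 - plus_prob k) <=
    (1 - k.+1%:R / n%:R) * n%:R^-1.
  by apply: ler_wpM2l; [rewrite subr_ge0|have /andP[] := plus_prob_incr k].
have h2 : k%:R / n%:R * (plus_prob k - plus_prob k.-1) <= k%:R / n%:R * n%:R^-1.
  apply: ler_wpM2l => //.
  case: k {kn f0 f1 g0 g1 h1} => [|k]; first by rewrite subrr ltW.
  by have /andP[] := plus_prob_incr k.
have e : (1 - k.+1%:R / n%:R) * n%:R^-1 + k%:R / n%:R * n%:R^-1
    = n%:R^-1 - n%:R^-1 ^+ 2 :> R by rewrite -natr1; ring.
lra.
Qed.

Lemma up_incr_norm k : (k < n)%N -> `|rate_up k - rate_up k.+1| <= 2 / n%:R.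
Proof.
move=> kn.
have -> : rate_up k - rate_up k.+1 =
   n%:R^-1 * plus_prob k - (1 - k.+1%:R / n%:R) * (plus_prob k.+1 - plus_prob k).
  by rewrite /rate_up -natr1; ring.
have /andP[p0 p1] := plus_prob_bounds kn.
have /andP[q0 q1] := plus_prob_incr k.
have /andP[g0 g1] := frac_itv kn.
move: g0 g1 p0 p1 q0 q1; move: (n%:R^-1) size_inv_gt0 (k.+1%:R / n%:R).
move: (plus_prob k) (plus_prob k.+1 - plus_prob k) => p q b b0 a *.
by rewrite ler_norml; apply/andP; split; nra.
Qed.

Lemma count_step_le f g : (forall k, (k <= n)%N -> f k <= g k) ->
  forall k, (k <= n)%N -> K f k <= K g k.
Proof.
move=> fg k kn; rewrite /K !lerD //.
- move: kn; rewrite leq_eqVlt => /orP[/eqP ->|kn]; first by rewrite up_n !mul0r.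
  by apply: ler_wpM2l; [exact/up_ge0/ltnW|exact: fg].
- apply: ler_wpM2l; first exact: down_ge0.
  by apply: fg; rewrite (leq_trans (leq_pred _)).
- by apply: ler_wpM2l; [have := hold_ge kn; lra|exact: fg].
Qed.

(** Affine combinations of two functions cover every one-step inequality iterated below; terms with
    coefficient 0 are padding to reach this shape. *)
Lemma count_step_lin (a b c : R) f g k :
  K (fun j => a * f j + b * g j + c) k = a * K f k + b * K g k + c.
Proof. by rewrite /K; ring. Qed.

Lemma iter_count_step_le t f g : (forall k, (k <= n)%N -> f k <= g k) ->
  forall k, (k <= n)%N -> iter t K f k <= iter t K g k.
Proof. by move=> fg; elim: t => [//|t IH] k kn; exact: count_step_le. Qed.

Lemma iter_count_step_lin t (a b c : R) f g k :
  iter t K (fun j => a * f j + b * g j + c) k =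
  a * iter t K f k + b * iter t K g k + c.
Proof.
elim: t k => [//|t IH] k /=.
by rewrite -count_step_lin /K !IH.
Qed.

Lemma iter_count_step_cst t (c : R) k : iter t K (fun=> c) k = c.
Proof. by elim: t k => [//|t IH] k /=; rewrite /K !IH; ring. Qed.

(** The variance of a three-valued jump is a sum over pairs of outcomes. Keeping only the pairs that
    involve holding, of probability at least 1/24, leaves the Dirichlet form. *)
Lemma count_step_var f k : (k <= n)%N ->
  24^-1 * (rate_up k * (f k.+1 - f k) ^+ 2 + rate_down k * (f k - f k.-1) ^+ 2) <=
  K (fun j => f j ^+ 2) k - K f k ^+ 2.
Proof.
move=> kn.
have -> : K (fun j => f j ^+ 2) k - K f k ^+ 2 =
    (1 - rate_up k - rate_down k) *
      (rate_up k * (f k.+1 - f k) ^+ 2 + rate_down k * (f k - f k.-1) ^+ 2) +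
    rate_up k * rate_down k * (f k.+1 - f k.-1) ^+ 2.
  by rewrite /K; ring.
have u0 := up_ge0 kn; have d0 := down_ge0 kn; have h0 := hold_ge kn.
rewrite -[leLHS]addr0; apply: lerD; last first.
  by apply: mulr_ge0; [exact: mulr_ge0|exact: sqr_ge0].
apply: ler_wpM2r => //.
by apply: addr_ge0; apply: mulr_ge0 => //; exact: sqr_ge0.
Qed.

Lemma count_step_sqr f k : (k <= n)%N -> K f k ^+ 2 <= K (fun j => f j ^+ 2) k.
Proof.
move=> kn; rewrite -subr_ge0; apply: le_trans (count_step_var f kn).
apply: mulr_ge0 => //; apply: addr_ge0; apply: mulr_ge0; try exact: sqr_ge0.
  exact: up_ge0.
exact: down_ge0.
Qed.

Lemma iter_count_step_sqr t f k : (k <= n)%N ->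
  iter t K f k ^+ 2 <= iter t K (fun j => f j ^+ 2) k.
Proof.
elim: t k => [//|t IH] k kn /=.
by apply: le_trans (count_step_sqr _ kn) _; exact: count_step_le.
Qed.

(** The discrete gradient evolves by a three-point operator of its own. Its weights are nonnegative
    with sum below 1, so it behaves like a chain with killing. *)
Lemma grad_count_step f k : K f k.+1 - K f k =
  rate_up k.+1 * (f k.+2 - f k.+1) + (1 - rate_up k - rate_down k.+1) * (f k.+1 - f k)
  + rate_down k * (f k - f k.-1).
Proof. by rewrite /K /=; ring. Qed.

End CountChain.

(** * Reverse Poincare inequality and gradient decay *)

Section Gradient.
Variables (R : realType) (n : nat).
Hypothesis n_gt0 : (0 < n)%N.
Implicit Types (f g : nat -> R) (k t : nat).

Local Notation K := (@count_step R n).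
Local Notation rate_up := (rate_up R n).
Local Notation rate_down := (rate_down R n).

Lemma sqr_wsum_le (a b c x y z : R) : 0 <= a -> 0 <= b -> 0 <= c ->
  a + b + c <= 1 ->
  (a * x + b * y + c * z) ^+ 2 <= a * x ^+ 2 + b * y ^+ 2 + c * z ^+ 2.
Proof.
move=> a0 b0 c0 s1; rewrite -subr_ge0.
have -> : a * x ^+ 2 + b * y ^+ 2 + c * z ^+ 2 - (a * x + b * y + c * z) ^+ 2 =
    (1 - (a + b + c)) * (a * x ^+ 2 + b * y ^+ 2 + c * z ^+ 2) +
    (a * b * (x - y) ^+ 2 + a * c * (x - z) ^+ 2 + b * c * (y - z) ^+ 2) by ring.
have h (u v : R) : 0 <= u -> 0 <= u * v ^+ 2 by move=> u0; rewrite mulr_ge0 ?sqr_ge0.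
by rewrite addr_ge0 ?mulr_ge0 ?subr_ge0 ?addr_ge0 ?h ?mulr_ge0.
Qed.

(** The bounds on [x] and [z] are required only under a positive weight, because at the ends of {0,
    ..., n} these gradients reach outside the range. *)
Lemma norm_wsum_le (a b c x y z d : R) : 0 <= a -> 0 <= b -> 0 <= c ->
  (0 < a -> `|x| <= d) -> `|y| <= d -> (0 < c -> `|z| <= d) ->
  `|a * x + b * y + c * z| <= (a + b + c) * d.
Proof.
have aux (u v : R) : 0 <= u -> (0 < u -> `|v| <= d) -> `|u * v| <= u * d.
  rewrite le_eqVlt => /orP[/eqP <-|u0 /(_ u0) vd]; first by rewrite !mul0r normr0.
  by rewrite normrM gtr0_norm // ler_pM2l.
move=> a0 b0 c0 xd yd zd; rewrite !mulrDl.
by apply: le_trans (ler_normD _ _) _; rewrite lerD ?aux //;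
   apply: le_trans (ler_normD _ _) _; rewrite lerD ?aux.
Qed.

Lemma up_gt0_lt k : (k <= n)%N -> 0 < rate_up k -> (k < n)%N.
Proof.
by rewrite leq_eqVlt => /orP[/eqP ->|//]; rewrite up_n // ltxx.
Qed.

Lemma grad_contraction f (d : R) : 0 <= d ->
  (forall k, (k < n)%N -> `|f k.+1 - f k| <= d) ->
  forall k, (k < n)%N -> `|K f k.+1 - K f k| <= (1 - n%:R^-1 ^+ 2) * d.
Proof.
move=> d0 fd k kn; rewrite grad_count_step.
apply: le_trans (ler_wpM2r d0 (drift_contraction R n_gt0 kn)).
apply: norm_wsum_le; rewrite ?up_ge0 ?down_ge0 // 1?ltnW //; last 1 first.
- by move=> _; case: k kn => [|k] kn; rewrite ?subrr ?normr0 //; exact/fd/ltnW.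
- by have /andP[_] := up_down_ge R n_gt0 kn; rewrite -subr_ge0 => h; lra.
- by move=> /up_gt0_lt -/(_ kn) /fd.
- exact: fd.
Qed.

Lemma iter_grad_contraction g t (d : R) : 0 <= d ->
  (forall k, (k < n)%N -> `|g k.+1 - g k| <= d) ->
  forall k, (k < n)%N ->
    `|iter t K g k.+1 - iter t K g k| <= (1 - n%:R^-1 ^+ 2) ^+ t * d.
Proof.
move=> d0 gd; elim: t => [|t IH] k kn /=; first by rewrite mul1r gd.
rewrite exprS -mulrA; apply: grad_contraction => //.
rewrite mulr_ge0 // exprn_ge0 // subr_ge0 expr_le1 ?invr_ge0 //.
by rewrite invf_le1 ?ltr0n // ler1n.
Qed.

Lemma grad_count_step_sqr f k : (k < n)%N ->
  (K f k.+1 - K f k) ^+ 2 <= rate_up k.+1 * (f k.+2 - f k.+1) ^+ 2 +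
    (1 - rate_up k - rate_down k.+1) * (f k.+1 - f k) ^+ 2 + rate_down k * (f k - f k.-1) ^+ 2.
Proof.
move=> kn; rewrite grad_count_step; apply: sqr_wsum_le.
- exact: up_ge0.
- by have /andP[_] := up_down_ge R n_gt0 kn; lra.
- exact/down_ge0/ltnW.
- apply: le_trans (drift_contraction R n_gt0 kn) _.
  by rewrite gerBl sqr_ge0.
Qed.

Definition cond_var f k : R := K (fun j => f j ^+ 2) k - K f k ^+ 2.

(** One factor 1/24 is the holding probability in [count_step_var]. The other bounds below the
    weight [rate_up k + rate_down k.+1] with which the edge between [k] and [k.+1] appears in the
    two variances together. *)
Lemma cond_var_grad f k : (k < n)%N ->
  24^-1 ^+ 2 * (K f k.+1 - K f k) ^+ 2 <= cond_var f k + cond_var f k.+1.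
Proof.
move=> kn; have := count_step_var n_gt0 f (ltnW kn).
have := count_step_var n_gt0 f kn; have := grad_count_step_sqr f kn.
have /andP[] := up_down_ge R n_gt0 kn.
have := up_ge0 R n_gt0 kn; have := down_ge0 R n_gt0 (ltnW kn).
rewrite -/(cond_var f k) -/(cond_var f k.+1) [k.+1.-1]/=.
have : 0 <= (f k.+2 - f k.+1) ^+ 2 by exact: sqr_ge0.
have : 0 <= (f k.+1 - f k) ^+ 2 by exact: sqr_ge0.
have : 0 <= (f k - f k.-1) ^+ 2 by exact: sqr_ge0.
move: ((f k.+2 - f k.+1) ^+ 2) ((f k.+1 - f k) ^+ 2) ((f k - f k.-1) ^+ 2).
move: ((K f k.+1 - K f k) ^+ 2) (cond_var f k) (cond_var f k.+1).
move: (rate_up k) (rate_up k.+1) (rate_down k) (rate_down k.+1) => u u' d d' G V V' X Y Z.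
move=> Z0 Y0 X0 d0 u0 c1 c2 h1 h2 h3.
have a1 : 0 <= u' * X by exact: mulr_ge0.
have a2 : 0 <= d * Z by exact: mulr_ge0.
have a3 : 24^-1 * Y <= (u + d') * Y by exact: ler_wpM2r.
have a4 : (1 - u - d') * Y <= 1 * Y by apply: ler_wpM2r => //; lra.
lra.
Qed.

(** Compares the gradient operator, applied to the edge sums [A j + A j.+1], with the chain applied
    to [A] at both endpoints. The difference is a killing term of favourable sign and the increment
    of [A] times that of [rate_up], which is at most 2/n. *)
Lemma count_step_add_ge (A : nat -> R) (d : R) k : (k < n)%N ->
  0 <= A k -> `|A k.+1 - A k| <= d ->
  rate_up k.+1 * (A k.+1 + A k.+2) + (1 - rate_up k - rate_down k.+1) * (A k + A k.+1)
    + rate_down k * (A k.-1 + A k) <= K A k + K A k.+1 + 4 * d / n%:R.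
Proof.
move=> kn A0 Ad; rewrite -subr_ge0.
have -> : K A k + K A k.+1 + 4 * d / n%:R -
   (rate_up k.+1 * (A k.+1 + A k.+2) + (1 - rate_up k - rate_down k.+1) * (A k + A k.+1)
    + rate_down k * (A k.-1 + A k)) =
   2 * (1 - (rate_up k.+1 + (1 - rate_up k - rate_down k.+1) + rate_down k)) * A k +
   2 * (d * (2 / n%:R) + (A k.+1 - A k) * (rate_up k - rate_up k.+1)).
  by rewrite /count_step /=; ring.
have := drift_contraction R n_gt0 kn.
have : 0 <= n%:R^-1 ^+ 2 :> R by exact: sqr_ge0.
move=> s0 h; rewrite addr_ge0 //; first by rewrite !mulr_ge0 //; lra.
rewrite mulr_ge0 // -lerBlDr sub0r.
apply: le_trans (ler_norm _) _; rewrite normrN normrM.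
by apply: ler_pM => //; exact: up_incr_norm.
Qed.

(* Two neighbouring chains gather, at every step, a conditional variance at
   least of the order of the squared gradient; [A] is the variance accumulated
   so far.  The error [4 * d / n] is there because only the drift
   [rate_up - rate_down] is monotone, not the two rates separately. *)
Lemma reverse_poincare_step (f A : nat -> R) (c d e : R) :
  0 <= c -> 0 <= e ->
  (forall k, (k <= n)%N -> 0 <= A k) ->
  (forall k, (k < n)%N -> `|A k.+1 - A k| <= d) ->
  (forall k, (k < n)%N -> c * (f k.+1 - f k) ^+ 2 <= A k + A k.+1 + e) ->
  forall k, (k < n)%N -> (c + 24^-1 ^+ 2) * (K f k.+1 - K f k) ^+ 2 <=
    (K A k + cond_var f k) + (K A k.+1 + cond_var f k.+1) + (e + 4 * d / n%:R).
Proof.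
move=> c0 e0 A0 Ad fA k kn; rewrite mulrDl.
have h1 := cond_var_grad f kn.
have h2 := count_step_add_ge kn (A0 _ (ltnW kn)) (Ad _ kn).
have h3 := ler_wpM2l c0 (grad_count_step_sqr f kn).
have d1 := drift_contraction R n_gt0 kn.
have s0 : 0 <= n%:R^-1 ^+ 2 :> R by exact: sqr_ge0.
have wX : rate_up k.+1 * (c * (f k.+2 - f k.+1) ^+ 2) <=
    rate_up k.+1 * (A k.+1 + A k.+2 + e).
  move: (kn); rewrite leq_eqVlt => /orP[/eqP ->|k1n].
    by rewrite up_n // !mul0r.
  by apply: ler_wpM2l; [exact: up_ge0|exact: fA].
have wY : (1 - rate_up k - rate_down k.+1) * (c * (f k.+1 - f k) ^+ 2) <=
    (1 - rate_up k - rate_down k.+1) * (A k + A k.+1 + e).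
  apply: ler_wpM2l; last exact: fA.
  by have /andP[_] := up_down_ge R n_gt0 kn; lra.
have wZ : rate_down k * (c * (f k - f k.-1) ^+ 2) <= rate_down k * (A k.-1 + A k + e).
  case: k kn {h1 h2 h3 d1 wX wY} => [|k] kn; first by rewrite down_0 !mul0r.
  by apply: ler_wpM2l; [exact/down_ge0/ltnW|exact/fA/ltnW].
have we : (rate_up k.+1 + (1 - rate_up k - rate_down k.+1) + rate_down k) * e <= 1 * e.
  by apply: ler_wpM2r => //; lra.
lra.
Qed.

Definition iter_var t g k : R := iter t K (fun j => g j ^+ 2) k - iter t K g k ^+ 2.

(** Law of total variance, conditioning on the first step: [iter_var t g k] is the variance of [g]
    after [t] steps from [k]. *)
Lemma iter_varS t g k :
  iter_var t.+1 g k = K (iter_var t g) k + cond_var (iter t K g) k.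
Proof. by rewrite /iter_var /cond_var /= /count_step; ring. Qed.

Definition unit_valued g := forall k, (k <= n)%N -> 0 <= g k <= 1.

Lemma unit_valued_sqr g : unit_valued g -> unit_valued (fun j => g j ^+ 2).
Proof.
by move=> gu k /gu /andP[g0 g1]; rewrite sqr_ge0 expr_le1.
Qed.

Lemma unit_valued_iter t g : unit_valued g -> unit_valued (iter t K g).
Proof.
move=> gu k kn; apply/andP; split.
  rewrite -[leLHS](@iter_count_step_cst R n t 0 k).
  by apply: iter_count_step_le => // j /gu /andP[].
rewrite -[leRHS](@iter_count_step_cst R n t 1 k).
by apply: iter_count_step_le => // j /gu /andP[].
Qed.

(** Quantifying over all [g] with values in [0, 1] lets the same bound be used for the square of
    [g], as the gradient of the variance demands. *)
Definition grad_bound t (b : R) := forall g, unit_valued g ->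
  forall k, (k < n)%N -> `|iter t K g k.+1 - iter t K g k| <= b.

Lemma iter_var_bounds t g : unit_valued g ->
  forall k, (k <= n)%N -> 0 <= iter_var t g k <= 1.
Proof.
move=> gu k kn; rewrite /iter_var subr_ge0 iter_count_step_sqr //=.
have /andP[_] := unit_valued_iter t (unit_valued_sqr gu) kn.
by have := sqr_ge0 (iter t K g k); lra.
Qed.

(** One [b] comes from the square of [g], and two from a difference of squares of numbers in
    [0, 1]. *)
Lemma iter_var_grad t g (b : R) : grad_bound t b -> unit_valued g ->
  forall k, (k < n)%N -> `|iter_var t g k.+1 - iter_var t g k| <= 3 * b.
Proof.
move=> tb gu k kn; have h1 := tb _ (unit_valued_sqr gu) k kn.
have h2 := tb _ gu k kn.
have /andP[a0 a1] := unit_valued_iter t gu (ltnW kn).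
have /andP[b0 b1] := unit_valued_iter t gu kn.
have -> : iter_var t g k.+1 - iter_var t g k =
  (iter t K (fun j => g j ^+ 2) k.+1 - iter t K (fun j => g j ^+ 2) k) -
  (iter t K g k.+1 - iter t K g k) * (iter t K g k.+1 + iter t K g k).
  by rewrite /iter_var; ring.
apply: le_trans (ler_normB _ _) _; rewrite normrM.
have -> : 3 * b = b + b * 2 by ring.
apply: lerD => //; apply: ler_pM => //.
by rewrite ger0_norm; lra.
Qed.

(** Each step raises the coefficient of the squared gradient by 1/24^2 and adds the error 4 * (3 *
    b) / n, the 3 being that of [iter_var_grad]. *)
Lemma reverse_poincare (b : nat -> R) t g :
  (forall s, 0 <= b s) -> (forall s, (s < t)%N -> grad_bound s (b s)) ->
  unit_valued g -> forall k, (k < n)%N ->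
    t%:R * 24^-1 ^+ 2 * (iter t K g k.+1 - iter t K g k) ^+ 2 <=
    iter_var t g k + iter_var t g k.+1 + 12 / n%:R * \sum_(s < t) b s.
Proof.
move=> b0 + gu; elim: t => [|t IH] tb k kn.
  by rewrite !mul0r big_ord0 mulr0 addr0 /iter_var /= !subrr addr0.
have {}IH := IH (fun s st => tb s (ltnW st)).
rewrite big_ord_recr /= mulrDr !iter_varS -natr1 mulrDl mul1r.
have -> : 12 / n%:R * b t = 4 * (3 * b t) / n%:R by ring.
apply: reverse_poincare_step => //.
- by apply: mulr_ge0 => //; exact: sumr_ge0.
- by move=> j /(iter_var_bounds t gu) /andP[].
- by apply: iter_var_grad => //; exact: tb.
Qed.

End Gradient.

(** * Gradient decay of order t^(-1/2) up to time n^2 *)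

Section GradientDecay.
Variables (R : realType).

Lemma sum_inv_sqrt_le t :
  \sum_(s < t) (Num.sqrt s.+1%:R)^-1 <= 2 * Num.sqrt t%:R :> R.
Proof.
elim: t => [|t IH]; first by rewrite big_ord0 mulr_ge0 ?sqrtr_ge0.
rewrite big_ord_recr /=.
have a0 : 0 < Num.sqrt t.+1%:R :> R by rewrite sqrtr_gt0.
have ea : Num.sqrt t.+1%:R ^+ 2 = t%:R + 1 :> R by rewrite sqr_sqrtr // natr1.
have eb : Num.sqrt t%:R ^+ 2 = t%:R :> R by rewrite sqr_sqrtr.
suff : (Num.sqrt t.+1%:R)^-1 <= 2 * (Num.sqrt t.+1%:R - Num.sqrt t%:R) :> R by lra.
move: a0 ea eb {IH}; move: (Num.sqrt _) (Num.sqrt _) => a b a0 ea eb.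
rewrite -[leLHS]mul1r ler_pdivrMr //.
have := sqr_ge0 (a - b); nra.
Qed.

(** Strong induction on [t]: the bounds at earlier times control the error in [reverse_poincare],
    whose variances are at most 1. *)
Lemma grad_decay : exists2 B : R, 0 < B &
  forall n t, (0 < n)%N -> (t <= n ^ 2)%N ->
    @grad_bound R n t (B / Num.sqrt t.+1%:R).
Proof.
(* The induction closes when B^2 dominates 24^2 (2 + 24 B), doubled to pass from t to t + 1 <= 2t;
   [1 <= B] settles t = 0. *)
have [B [Bgt0 B1 hB]] : exists B : R,
    [/\ 0 < B, 1 <= B & 24 * 24 * (2 * (2 + 24 * B)) <= B ^+ 2].
  by exists (240 * 240); split; [lra|lra|rewrite expr2; lra].
exists B => // n t n0; elim/ltn_ind: t => t IH tn g gu k kn.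
have nn : 0 < n%:R :> R by rewrite ltr0n.
have s0 : 0 < Num.sqrt t.+1%:R :> R by rewrite sqrtr_gt0.
have f0 := unit_valued_iter n0 t gu (ltnW kn).
have f1 := unit_valued_iter n0 t gu kn.
set D := _ - _; rewrite ler_pdivlMr //.
case: (posnP t) => [t0|t0].
  rewrite t0 sqrtr1 mulr1 ler_norml /D; move: f0 f1.
  by move: (iter _ _ _ _) (iter _ _ _ _) => x y; lra.
have b0 s : 0 <= B / Num.sqrt s.+1%:R by rewrite divr_ge0 ?sqrtr_ge0 // ltW.
have IH' s : (s < t)%N -> grad_bound n s (B / Num.sqrt s.+1%:R).
  by move=> st; apply: IH => //; exact: leq_trans (ltnW st) tn.
have := reverse_poincare n0 b0 IH' gu kn.
have /andP[_ v0] := iter_var_bounds n0 t gu (ltnW kn).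
have /andP[_ v1] := iter_var_bounds n0 t gu kn.
rewrite -mulr_sumr -/D => h.
(* The restriction [t <= n ^ 2] is used here: the sum of the earlier bounds is at most 2 B n, which
   the factor 12/n turns into a constant. *)
have sn : Num.sqrt t%:R <= n%:R :> R.
  by rewrite -[leRHS]ger0_norm // -sqrtr_sqr ler_wsqrtr // -natrX ler_nat.
have h1 : 12 / n%:R * (B * \sum_(s < t) (Num.sqrt s.+1%:R)^-1) <= 24 * B.
  have -> : 24 * B = 12 / n%:R * (B * (2 * n%:R)) by field; rewrite gt_eqF.
  apply: ler_wpM2l; first by rewrite divr_ge0.
  rewrite ler_pM2l //; apply: le_trans (sum_inv_sqrt_le t) _.
  by rewrite ler_pM2l.
have h2 : t%:R * 24^-1 ^+ 2 * D ^+ 2 <= 2 + 24 * B by lra.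
rewrite -ler_sqr ?nnegrE ?(ltW Bgt0) ?mulr_ge0 ?sqrtr_ge0 // exprMn real_normK ?num_real //.
rewrite sqr_sqrtr // -natr1 mulrDr mulr1.
have t1 : 1 <= t%:R :> R by rewrite ler1n.
have := sqr_ge0 D; move: (D ^+ 2) h2 => X h2 X0.
have h3 : X * 1 <= X * t%:R by exact: ler_wpM2l.
lra.
Qed.

End GradientDecay.

(** * The second moment of the magnetization *)

Section SecondMoment.
Variables (R : realType) (n : nat).
Hypothesis n_gt0 : (0 < n)%N.
Implicit Types (k t : nat).

Local Notation K := (@count_step R n).
Local Notation rate_up := (rate_up R n).
Local Notation rate_down := (rate_down R n).

Definition spin_mean k : R := 2 * k%:R / n%:R - 1.

Lemma spin_mean_bounds k : (k <= n)%N -> -1 <= spin_mean k <= 1.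
Proof.
by move=> kn; have := frac_itv R n_gt0 kn; rewrite /spin_mean -mulrA; lra.
Qed.

Lemma tanh_near (x y d : R) : `|x - y| <= d -> `|tanh x - tanh y| <= d.
Proof.
have [xy|/ltW xy] := leP x y; rewrite !ler_norml;
  have := tanh_le xy; have := tanh_lipschitz xy; lra.
Qed.

(** Leaving out the updated site shifts the field by 1/n up or down, and tanh is 1-Lipschitz. At
    [k = 0] the downward shift is replaced by a default value, whose weight 1 + s vanishes. *)
Lemma rate_drift k : (k <= n)%N ->
  `|rate_up k - rate_down k - (tanh (spin_mean k) - spin_mean k) / 2|
    <= (2 * n%:R)^-1.
Proof.
move=> kn; have nn : 0 < n%:R :> R by rewrite ltr0n.
set s := spin_mean k.
have ks : k%:R / n%:R = (1 + s) / 2 :> R by rewrite /s /spin_mean; field; rewrite gt_eqF.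
have s1 := spin_mean_bounds kn; rewrite -/s in s1.
set T1 := tanh ((2 * k%:R + 1) / n%:R - 1) : R.
set T0 := tanh ((2 * k.-1%:R + 1) / n%:R - 1) : R.
have -> : rate_up k - rate_down k - (tanh s - s) / 2 =
    ((1 - s) * (T1 - tanh s) + (1 + s) * (T0 - tanh s)) / 4.
  rewrite /rate_up /rate_down /plus_prob /p_plus !mul1r -/T1 -/T0 ks.
  by field.
have h1 : (1 - s) * `|T1 - tanh s| <= (1 - s) * n%:R^-1.
  apply: ler_wpM2l; first lra.
  apply: tanh_near; rewrite /s /spin_mean mulrDl mul1r.
  by rewrite [X in `|X|](_ : _ = n%:R^-1) ?ger0_norm ?invr_ge0 //; ring.
have h0 : (1 + s) * `|T0 - tanh s| <= (1 + s) * n%:R^-1.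
  move: (kn); rewrite /T0 /s /spin_mean; case: (k) => [|j] _ /=.
    by rewrite mulr0 mul0r addrCA subrr addr0 !mul0r.
  have /andP[f0 _] : 0 <= (j.+1%:R / n%:R : R) <= 1 + j.+1%:R / n%:R.
    by rewrite lerDr ler01 andbT divr_ge0.
  apply: ler_wpM2l; first by rewrite -mulrA; lra.
  apply: tanh_near; rewrite -(natr1 j).
  rewrite [X in `|X|](_ : _ = - n%:R^-1) ?normrN ?ger0_norm ?invr_ge0 //; ring.
have -> : (2 * n%:R)^-1 = ((1 - s) * n%:R^-1 + (1 + s) * n%:R^-1) / 4.
  by rewrite invfM; field; rewrite gt_eqF.
rewrite normrM [`|4^-1|]ger0_norm // ler_wpM2r //.
apply: le_trans (ler_normD _ _) _; rewrite !normrM.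
by rewrite (@ger0_norm _ (1 - s)) ?(@ger0_norm _ (1 + s)) ?lerD //; lra.
Qed.

Lemma count_step_sqr_dist (c : R) k : (k <= n)%N -> 0 <= c <= 1 ->
  K (fun j => (spin_mean j - c) ^+ 2) k <= (spin_mean k - c) ^+ 2 +
    2 / n%:R * ((spin_mean k - c) * (tanh (spin_mean k) - spin_mean k)) +
    8 / n%:R ^+ 2.
Proof.
move=> kn c01; have nn : 0 < n%:R :> R by rewrite ltr0n.
have := rate_drift kn; have h0 := hold_ge R n_gt0 kn.
have := spin_mean_bounds kn.
have -> : K (fun j => (spin_mean j - c) ^+ 2) k = (spin_mean k - c) ^+ 2 +
    4 / n%:R * ((spin_mean k - c) * (rate_up k - rate_down k)) +
    4 / n%:R ^+ 2 * (rate_up k + rate_down k).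
  rewrite /count_step; case: k kn {h0} => [|k] kn.
    by rewrite down_0 /spin_mean; field; rewrite gt_eqF.
  by rewrite /= /spin_mean -(natr1 k.+1) -(natr1 k); field; rewrite gt_eqF.
move: (spin_mean k) => s s1.
set e := (X in `|X| <= _) => he.
have eb : rate_up k - rate_down k = (tanh s - s) / 2 + e by rewrite /e; ring.
rewrite {}eb.
have h1 : (s - c) * e <= 2 * (2 * n%:R)^-1.
  apply: le_trans (ler_norm _) _; rewrite normrM.
  by apply: ler_pM => //; rewrite ler_norml; lra.
have h2 : 4 / n%:R * ((s - c) * e) <= 4 / n%:R * (2 * (2 * n%:R)^-1).
  by apply: ler_wpM2l => //; rewrite divr_ge0.
have h3 : 4 / n%:R ^+ 2 * (rate_up k + rate_down k) <= 4 / n%:R ^+ 2 * 1 :> R.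
  by apply: ler_wpM2l; [rewrite divr_ge0 ?sqr_ge0|lra].
(* Half of the 8 is the drift error, half the squared jump length (2/n)^2. *)
have e1 : 4 / n%:R * (2 * (2 * n%:R)^-1) + 4 / n%:R ^+ 2 * 1 = 8 / n%:R ^+ 2 :> R.
  by field; rewrite gt_eqF.
have e2 : 4 / n%:R * ((s - c) * ((tanh s - s) / 2 + e)) =
   2 / n%:R * ((s - c) * (tanh s - s)) + 4 / n%:R * ((s - c) * e).
  by field; rewrite gt_eqF.
lra.
Qed.

End SecondMoment.

(** * Spread and contraction of the count chain on the time scale n^(3/2) *)

Section CountMixing.
Variables (R : realType).
Implicit Types (n k t : nat).

(** The drift points to 0, so it moves [s] away from [c] only when s lies between 0 and [c]; there
    both factors are controlled by [c] and [c ^+ 3]. *)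
Lemma mul_tanh_sub_le (c s : R) : 0 <= c ->
  (s - c) * (tanh s - s) <= c ^+ 4.
Proof.
move=> c0; have c4 : 0 <= c ^+ 4 by exact: exprn_ge0.
have [s0|/ltW s0] := leP 0 s; last first.
  have := tanh_lipschitz s0; rewrite tanh0 !sub0r lerN2 => ts.
  apply: le_trans c4; apply: mulr_le0_ge0; lra.
have ts := tanh_le_id s0; have ts3 := id_sub_tanh_le s0.
have [sc|/ltW sc] := leP s c; last first.
  by apply: le_trans c4; apply: mulr_ge0_le0; lra.
have -> : (s - c) * (tanh s - s) = (c - s) * (s - tanh s) by ring.
have -> : c ^+ 4 = c * c ^+ 3 by ring.
apply: ler_pM; try lra.
by apply: le_trans ts3 _; rewrite lerXn2r ?nnegrE.
Qed.

Lemma iter_count_step_sqr_dist n t (c : R) k : (0 < n)%N -> (k <= n)%N ->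
  0 <= c <= 1 ->
  iter t (@count_step R n) (fun j => (spin_mean R n j - c) ^+ 2) k <=
    (spin_mean R n k - c) ^+ 2 + t%:R * (2 / n%:R * c ^+ 4 + 8 / n%:R ^+ 2).
Proof.
move=> n0 kn c01; set e := 2 / _ * _ + _.
set V := (fun j => _).
have step j : (j <= n)%N -> count_step n V j <= 1 * V j + 0 * V j + e.
  move=> jn; rewrite mul1r mul0r addr0.
  apply: le_trans (count_step_sqr_dist n0 jn c01) _.
  rewrite -addrA lerD2l lerD2r; apply: ler_wpM2l; first exact: divr_ge0.
  by apply: mul_tanh_sub_le; case/andP: c01.
rewrite -/(V k); move: e step => e step.
elim: t k kn => [|t IH] k kn; first by rewrite mul0r addr0.
rewrite iterSr; apply: le_trans (iter_count_step_le n0 t step kn) _.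
rewrite iter_count_step_lin mul1r mul0r addr0.
have -> : t.+1%:R * e = t%:R * e + e by rewrite -natr1; ring.
by rewrite addrA lerD2r; exact: IH.
Qed.

Lemma count_step_sqr_mean n k : (0 < n)%N -> (k <= n)%N ->
  count_step n (fun j => spin_mean R n j ^+ 2) k <=
    spin_mean R n k ^+ 2 - (6 * n%:R)^-1 * (spin_mean R n k ^+ 2) ^+ 2
      + 8 / n%:R ^+ 2.
Proof.
move=> n0 kn; have nn : 0 < n%:R :> R by rewrite ltr0n.
have := @count_step_sqr_dist R n n0 0 k kn.
rewrite lexx ler01 => /(_ isT); rewrite /count_step !subr0 => h.
apply: le_trans h _; rewrite lerD2r lerD2l.
have : `|spin_mean R n k| <= 1 by rewrite ler_norml spin_mean_bounds.
move=> /mul_tanh_le; rewrite mulrBr; move: (spin_mean R n k) => s hs.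
have -> : - ((6 * n%:R)^-1 * (s ^+ 2) ^+ 2) = 2 / n%:R * (- (s ^+ 4 / 12)).
  by field; rewrite gt_eqF.
apply: ler_wpM2l; first by rewrite divr_ge0.
by rewrite -expr2; lra.
Qed.

(** The term y = 6N / (t + 3) is a supersolution of the recursion without noise, and [a] absorbs the
    noise: a^2 / (6N) = 49 / (6N^2) exceeds 8 / N^2. The map u - u^2 / (6N) is increasing in the
    range at hand because u + a + y <= 8 + 2N <= 6N; the shift by 3 ensures y <= 2N. *)
Lemma riccati_step (N a t u : R) : 2 <= N -> 0 <= a <= 7 -> a ^+ 2 = 49 / N ->
  0 <= t -> 0 <= u <= 1 -> u <= a + 6 * N / (t + 3) ->
  u - (6 * N)^-1 * u ^+ 2 + 8 / N ^+ 2 <= a + 6 * N / (t + 4).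
Proof.
move=> N2 a7 ea t0 u01 hu; have N0 : 0 < N by lra.
set y := 6 * N / (t + 3) in hu.
have y0 : 0 <= y by rewrite divr_ge0 //; lra.
have y2 : y <= 2 * N.
  by rewrite /y ler_pdivrMr; [nra|lra].
have h1 : u - (6 * N)^-1 * u ^+ 2 <= a + y - (6 * N)^-1 * (a + y) ^+ 2.
  rewrite -subr_ge0.
  have -> : a + y - (6 * N)^-1 * (a + y) ^+ 2 - (u - (6 * N)^-1 * u ^+ 2) =
      (a + y - u) * ((6 * N - (u + (a + y))) / (6 * N)).
    by field; rewrite gt_eqF.
  apply: mulr_ge0; first lra.
  apply: divr_ge0; lra.
have h2 : a + y - (6 * N)^-1 * (a + y) ^+ 2 + 8 / N ^+ 2 <=
    a + y - (6 * N)^-1 * y ^+ 2.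
  have -> : a + y - (6 * N)^-1 * (a + y) ^+ 2 =
     a + y - (6 * N)^-1 * y ^+ 2 - (6 * N)^-1 * a ^+ 2 - (3 * N)^-1 * (a * y).
    by field; rewrite gt_eqF.
  rewrite ea.
  have -> : (6 * N)^-1 * (49 / N) = 8 / N ^+ 2 + (6 * N ^+ 2)^-1.
    by field; rewrite gt_eqF.
  have : 0 <= (6 * N ^+ 2)^-1.
    by rewrite invr_ge0; apply: mulr_ge0 => //; exact: sqr_ge0.
  have : 0 <= (3 * N)^-1 * (a * y).
    apply: mulr_ge0; first by rewrite invr_ge0; lra.
    by apply: mulr_ge0 => //; case/andP: a7.
  lra.
have h3 : y - (6 * N)^-1 * y ^+ 2 <= 6 * N / (t + 4).
  rewrite -subr_ge0.
  have -> : 6 * N / (t + 4) - (y - (6 * N)^-1 * y ^+ 2) =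
      6 * N / ((t + 4) * (t + 3) ^+ 2).
    by rewrite /y; field; rewrite !gt_eqF //; lra.
  by rewrite divr_ge0 ?mulr_ge0 ?sqr_ge0 //; lra.
lra.
Qed.

Lemma second_moment_decay n t (w : R) k : (2 <= n)%N -> 1 <= w ->
  w ^+ 4 = n%:R -> (k <= n)%N ->
  iter t (@count_step R n) (fun j => spin_mean R n j ^+ 2) k <=
    7 / w ^+ 2 + 6 * n%:R / (t%:R + 3).
Proof.
move=> n2 w1 wn kn; have n0 : (0 < n)%N by exact: leq_trans n2.
have nn : 0 < n%:R :> R by rewrite ltr0n.
have w2 : 1 <= w ^+ 2 by exact: exprn_ege1.
have a7 : 0 <= 7 / w ^+ 2 <= 7.
  by rewrite divr_ge0 ?sqr_ge0 //= ler_pdivrMr; lra.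
have V01 : unit_valued n (fun j => spin_mean R n j ^+ 2).
  move=> j jn; rewrite sqr_ge0 /=.
  have := spin_mean_bounds R n0 jn; rewrite -ler_norml => h.
  by rewrite -real_normK ?num_real // expr_le1.
elim: t => [|t IH].
  have /andP[_ h] := V01 _ kn; apply: le_trans h _ => /=; rewrite add0r.
  have : 2 <= n%:R :> R by rewrite ler_nat.
  lra.
rewrite iterSr; set V := (fun j => _).
have step j : (j <= n)%N -> count_step n V j <=
    1 * V j + (- (6 * n%:R)^-1) * (V j ^+ 2) + 8 / n%:R ^+ 2.
  move=> jn; rewrite mul1r mulNr; exact: count_step_sqr_mean.
apply: le_trans (iter_count_step_le n0 t step kn) _.
rewrite iter_count_step_lin mul1r mulNr.
have -> : t.+1%:R + 3 = t%:R + 4 :> R by rewrite -natr1; ring.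
(* Jensen's inequality bounds the mean of [V ^+ 2] below by the square of the mean of [V], which
   closes the recursion. *)
apply: le_trans (riccati_step _ a7 _ (ler0n _ t) (unit_valued_iter n0 t V01 kn) IH).
- rewrite lerD2r lerD2l lerN2; apply: ler_wpM2l.
    by rewrite invr_ge0 mulr_ge0.
  exact: iter_count_step_sqr.
- by rewrite ler_nat.
- by rewrite exprMn exprVn -exprM wn; ring.
Qed.

Lemma grad_bound_osc n (f : nat -> R) (d : R) : (0 < n)%N ->
  (forall k, (k < n)%N -> `|f k.+1 - f k| <= d) ->
  forall k l, (k <= n)%N -> (l <= n)%N ->
    `|f k - f l| <= d * (n%:R / 2) * `|spin_mean R n k - spin_mean R n l|.
Proof.
move=> n0 fd; have nn : 0 < n%:R :> R by rewrite ltr0n.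
have main k j : (k + j <= n)%N -> `|f (k + j)%N - f k| <= d * j%:R.
  elim: j => [|j IH] kjn; first by rewrite addn0 subrr normr0 mulr0.
  rewrite addnS in kjn *; have := IH (ltnW kjn); have := fd _ kjn => h1 h2.
  have -> : f (k + j).+1 - f k = (f (k + j).+1 - f (k + j)%N) + (f (k + j)%N - f k) by ring.
  by apply: le_trans (ler_normD _ _) _; rewrite -natr1 mulrDr mulr1; lra.
move=> k l; wlog lk : k l / (l <= k)%N => [hw|] kn ln.
  have [lk|/ltnW lk] := leqP l k; first exact: hw.
  by rewrite distrC [X in _ * X]distrC; exact: hw.
have -> : spin_mean R n k - spin_mean R n l = 2 * (k - l)%:R / n%:R.
  by rewrite /spin_mean natrB //; ring.
rewrite (@ger0_norm _ (2 * _ / _)); last by rewrite divr_ge0 ?mulr_ge0.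
have -> : d * (n%:R / 2) * (2 * (k - l)%:R / n%:R) = d * (k - l)%:R.
  by field; rewrite gt_eqF.
by have := main l (k - l)%N; rewrite subnKC //; apply.
Qed.

(** After n^(3/2) steps the magnetization has size about 1/w, that is w^3 plus spins away from the
    middle, so a function with gradient [d] varies by about d w^3. *)
Lemma iter_count_step_near n m (w d : R) (F : nat -> R) : (2 <= n)%N -> 1 <= w ->
  w ^+ 4 = n%:R -> w ^+ 6 <= m%:R -> 0 <= d ->
  (forall k, (k < n)%N -> `|F k.+1 - F k| <= d) ->
  forall k, (k <= n)%N ->
    `|iter m (@count_step R n) F k - F n./2| <= 4 * d * w ^+ 3.
Proof.
move=> n2 w1 wn wm d0 Fd k kn; have n0 : (0 < n)%N by exact: leq_trans n2.
have nn : 0 < n%:R :> R by rewrite ltr0n.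
have w0 : 0 < w by lra.
have hn : (n./2 <= n)%N by rewrite -divn2 leq_div.
have hmid : `|spin_mean R n n./2| <= n%:R^-1.
  have e : n%:R = (odd n)%:R + 2 * n./2%:R :> R.
    by rewrite -natrM -natrD mul2n odd_double_half.
  have -> : spin_mean R n n./2 = - ((odd n)%:R / n%:R).
    have {}e : 2 * n./2%:R = n%:R - (odd n)%:R :> R by lra.
    by rewrite /spin_mean e; field; rewrite gt_eqF.
  rewrite normrN ger0_norm ?divr_ge0 // ler_pdivrMr // mulVf ?gt_eqF //.
  by case: (odd n); rewrite ?ler01.
pose V j := spin_mean R n j ^+ 2.
(* The coefficients come from |s| <= w s^2 / 2 + 1 / (2w), which makes the bound affine in the
   second moment; the last 1/n allows for odd [n], where the middle has magnetization -1/n. *)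
pose a := d * (n%:R / 2) * (w / 2).
pose b := d * (n%:R / 2) * ((2 * w)^-1 + n%:R^-1).
have a0 : 0 <= a by rewrite !mulr_ge0 ?divr_ge0 // ltW.
have key j : (j <= n)%N -> `|F j - F n./2| <= a * V j + b.
  move=> jn; apply: le_trans (grad_bound_osc n0 Fd jn hn) _.
  have -> : a * V j + b = d * (n%:R / 2) * (w / 2 * V j + (2 * w)^-1 + n%:R^-1).
    by rewrite /a /b; ring.
  apply: ler_wpM2l; first by rewrite mulr_ge0 ?divr_ge0.
  apply: le_trans (ler_normB _ _) _; apply: lerD => //.
  rewrite -subr_ge0 /V -(real_normK (num_real (spin_mean R n j))).
  set x := `|_|.
  have -> : w / 2 * x ^+ 2 + (2 * w)^-1 - x = (w * x - 1) ^+ 2 / (2 * w).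
    by field; rewrite gt_eqF.
  by rewrite divr_ge0 ?sqr_ge0 // mulr_ge0 // ltW.
have hV : iter m (@count_step R n) V k <= 13 / w ^+ 2.
  apply: le_trans (second_moment_decay m n2 w1 wn kn) _.
  have -> : 13 / w ^+ 2 = 7 / w ^+ 2 + 6 * n%:R / w ^+ 6.
    by rewrite -wn; field; rewrite gt_eqF.
  rewrite lerD2l; apply: ler_wpM2l; first by rewrite mulr_ge0.
  have w6 : 0 < w ^+ 6 by exact: exprn_gt0.
  by rewrite lef_pV2 ?posrE; lra.
(* With n = w^4 the left side equals d (7 w^3 + 1) / 2. *)
have tot : a * (13 / w ^+ 2) + b <= 4 * d * w ^+ 3.
  rewrite -subr_ge0.
  have -> : 4 * d * w ^+ 3 - (a * (13 / w ^+ 2) + b) = d / 2 * (w ^+ 3 - 1).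
    by rewrite /a /b -wn; field; rewrite gt_eqF.
  by rewrite mulr_ge0 ?divr_ge0 // subr_ge0 exprn_ege1.
have haV := ler_wpM2l a0 hV.
rewrite ler_norml; apply/andP; split.
- have := iter_count_step_le (f := fun j => (- a) * V j + 0 * V j + (F n./2 - b)) n0 m _ kn.
  move=> /(_ F); rewrite iter_count_step_lin mulNr mul0r addr0 => h.
  suff : - (a * iter m (count_step n) V k) + (F n./2 - b) <= iter m (count_step n) F k.
    by lra.
  apply: h => j /key; rewrite ler_norml mulNr mul0r addr0 => /andP[+ _].
  by lra.
- have := iter_count_step_le (g := fun j => a * V j + 0 * V j + (F n./2 + b)) n0 m _ kn.
  move=> /(_ F); rewrite iter_count_step_lin mul0r addr0 => h.
  suff : iter m (count_step n) F k <= a * iter m (count_step n) V k + (F n./2 + b).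
    by lra.
  apply: h => j /key; rewrite ler_norml mul0r addr0 => /andP[_].
  by lra.
Qed.

(** The inner M^2 m iterations flatten [g] to gradient at most 1 / (64 w^3); the outer m bring any
    two starting points close. Each value is then within 4/64 of the value at the middle, whence
    1/8. *)
Lemma count_chain_mixes : exists M N0 : nat, forall n m (w : R) (g : nat -> R),
  (N0 <= n)%N -> 1 <= w -> w ^+ 4 = n%:R -> w ^+ 6 <= m%:R <= 2 * w ^+ 6 ->
  unit_valued n g -> forall k l, (k <= n)%N -> (l <= n)%N ->
    `|iter (m + M ^ 2 * m) (@count_step R n) g k -
      iter (m + M ^ 2 * m) (@count_step R n) g l| <= 1 / 8.
Proof.
have [B B0 hB] := grad_decay R.
have [M hM] : exists M : nat, 64 * B <= M%:R.
  by exists (Num.bound (64 * B)); rewrite ltW // archi_boundP // mulr_ge0 // ltW.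
have M0 : 0 < M%:R :> R by apply: lt_le_trans hM; rewrite mulr_gt0.
(* From 4 M^4 <= n = w^4 follows 2 M^2 <= w^2, hence M^2 m <= n^2, the range of [grad_decay]. *)
exists M, (2 + 4 * M ^ 4)%N => n m w g nN w1 wn /andP[m1 m2] gu k l kn ln.
have n2 : (2 <= n)%N by exact: leq_trans (leq_addr _ _) nN.
have n0 : (0 < n)%N by exact: leq_trans n2.
have w0 : 0 < w by lra.
have tn : (M ^ 2 * m <= n ^ 2)%N.
  rewrite -(ler_nat R) natrM !natrX -wn.
  have Mw : 2 * M%:R ^+ 2 <= w ^+ 2.
    have a1 : 0 <= 2 * M%:R ^+ 2 :> R by apply: mulr_ge0 => //; exact: sqr_ge0.
    have a2 : 0 <= w ^+ 2 by exact: sqr_ge0.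
    rewrite -ler_sqr ?nnegrE // exprMn -!exprM wn.
    rewrite -natrX -natrX -natrM ler_nat.
    by apply: leq_trans nN; rewrite leq_addl.
  apply: le_trans (ler_wpM2l (sqr_ge0 _) m2) _.
  have -> : M%:R ^+ 2 * (2 * w ^+ 6) = 2 * M%:R ^+ 2 * w ^+ 6 by ring.
  have -> : (w ^+ 4) ^+ 2 = w ^+ 2 * w ^+ 6 by ring.
  by apply: ler_wpM2r => //; rewrite exprn_ge0 // ltW.
have := hB n (M ^ 2 * m)%N n0 tn g gu.
set d := B / _ => hd.
have dw : d * w ^+ 3 <= 1 / 64.
  have s0 : 0 < Num.sqrt (M ^ 2 * m).+1%:R :> R by rewrite sqrtr_gt0.
  rewrite /d mulrAC ler_pdivrMr //.
  have : M%:R * w ^+ 3 <= Num.sqrt (M ^ 2 * m).+1%:R :> R.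
    have a1 : 0 <= M%:R * w ^+ 3 by rewrite mulr_ge0 // exprn_ge0 // ltW.
    rewrite -ler_sqr ?nnegrE ?sqrtr_ge0 //.
    rewrite sqr_sqrtr // exprMn -exprM -natr1 natrM natrX.
    have := ler_wpM2l (sqr_ge0 (M%:R : R)) m1; lra.
  have : 64 * B * w ^+ 3 <= M%:R * w ^+ 3.
    by apply: ler_wpM2r => //; rewrite exprn_ge0 // ltW.
  lra.
have d0 : 0 <= d by rewrite divr_ge0 ?sqrtr_ge0 // ltW.
have near := iter_count_step_near n2 w1 wn m1 d0 hd.
rewrite !iterD; set F := iter (M ^ 2 * m)%N _ g in near *.
have := near k kn; have := near l ln.
rewrite !ler_norml => h1 h2; lra.
Qed.

End CountMixing.

(** * Configurations *)

Section Configurations.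
Variables (R : realType) (n : nat).
Implicit Types (s : config n) (i j : 'I_n) (b : bool) (f g : config n -> R).

Definition plus_count s : nat := \sum_(i < n) s i.

Definition site_prob s i : R := p_plus 1 (magnetization R s - spin R s i / n%:R).

Definition glauber_step f s : R := \sum_(s' : config n) glauber 1 s s' * f s'.

Lemma sum_delta (a : config n) f : \sum_(s : config n) (s == a)%:R * f s = f a.
Proof.
rewrite (bigD1 a) //= eqxx mul1r big1 ?addr0 // => s /negbTE ->.
by rewrite mul0r.
Qed.

Lemma glauber_stepE f s : glauber_step f s =
  \sum_(i < n) n%:R^-1 * (site_prob s i * f (set_spin s i true) +
                          (1 - site_prob s i) * f (set_spin s i false)).
Proof.
rewrite /glauber_step /glauber.
under eq_bigr do rewrite mulr_suml.
rewrite exchange_big /=; apply: eq_bigr => i _; rewrite -/(site_prob s i).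
rewrite -(sum_delta (set_spin s i true) f) -(sum_delta (set_spin s i false) f).
rewrite !mulr_sumr -big_split mulr_sumr; apply: eq_bigr => s' _ /=; ring.
Qed.

Lemma sum_law f s t :
  \sum_(s' : config n) law (@glauber R 1 n) s t s' * f s' = iter t glauber_step f s.
Proof.
elim: t f => [|t IH] f; first exact: sum_delta.
rewrite iterSr -IH /=.
under eq_bigr do rewrite mulr_suml.
rewrite exchange_big /=; apply: eq_bigr => z _; rewrite mulr_sumr.
by apply: eq_bigr => s' _; rewrite mulrA.
Qed.

Lemma set_spinE s i b k : set_spin s i b k = if k == i then b else s k.
Proof. by rewrite ffunE. Qed.

Lemma set_spin_id s i : set_spin s i (s i) = s.
Proof. by apply/ffunP => k; rewrite set_spinE; case: eqP => [->|]. Qed.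

Lemma set_spinK s i b b' : set_spin (set_spin s i b') i b = set_spin s i b.
Proof. by apply/ffunP => k; rewrite !set_spinE; case: eqP. Qed.

Lemma plus_count_le s : (plus_count s <= n)%N.
Proof.
rewrite -[leqRHS]muln1 -[X in (X * 1)%N]card_ord -sum_nat_const.
by apply: leq_sum => i _; case: (s i).
Qed.

(** Stated additively to avoid truncated subtraction. *)
Lemma plus_count_set s i b : (plus_count (set_spin s i b) + s i = plus_count s + b)%N.
Proof.
rewrite /plus_count (bigD1 i) //= [in RHS](bigD1 i) //= set_spinE eqxx.
have -> : (\sum_(k < n | k != i) set_spin s i b k = \sum_(k < n | k != i) s k)%N.
  by apply: eq_bigr => k /negbTE ki; rewrite set_spinE ki.
by rewrite -addnA [RHS]addnC; congr (_ + _)%N; rewrite addnC.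
Qed.

Lemma plus_count_lt s i : s i = false -> (plus_count s < n)%N.
Proof.
by move=> si; have := plus_count_le (set_spin s i true); have := plus_count_set s i true;
  rewrite si; lia.
Qed.

Lemma plus_count_gt0 s i : s i = true -> (0 < plus_count s)%N.
Proof. by move=> si; rewrite /plus_count (bigD1 i) //= si. Qed.

Lemma spinE s i : spin R s i = 2 * (s i)%:R - 1.
Proof. by rewrite /spin; case: (s i) => /=; ring. Qed.

Lemma sum_spin s : \sum_(i < n) spin R s i = 2 * (plus_count s)%:R - n%:R.
Proof.
under eq_bigr do rewrite spinE.
rewrite big_split /= -mulr_sumr natr_sum; congr (_ + _).
by rewrite sumr_const card_ord mulNrn.
Qed.

Hypothesis n_gt0 : (0 < n)%N.
Let size_gt0 : 0 < n%:R :> R. Proof. by rewrite ltr0n. Qed.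

Lemma magnetizationE s : magnetization R s = spin_mean R n (plus_count s).
Proof.
rewrite /magnetization sum_spin /spin_mean; field.
by rewrite gt_eqF.
Qed.

Lemma site_probE s i : site_prob s i =
  plus_prob R n (if s i then (plus_count s).-1 else plus_count s).
Proof.
rewrite /site_prob /plus_prob magnetizationE /spin_mean spinE; congr (p_plus _ _).
case si : (s i) => /=; last by ring.
by rewrite -[in LHS](prednK (plus_count_gt0 si)) -natr1; ring.
Qed.

Lemma site_prob_bounds s i : 24^-1 <= site_prob s i <= 1 - 24^-1.
Proof.
rewrite site_probE plus_prob_bounds //.
case si : (s i); last exact: plus_count_lt si.
by have := plus_count_le s; have := plus_count_gt0 si; lia.
Qed.

Lemma site_prob_ge0 s i : 0 <= site_prob s i.
Proof. by have := site_prob_bounds s i; lra. Qed.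

Lemma site_prob_le1 s i : 0 <= 1 - site_prob s i.
Proof. by have := site_prob_bounds s i; lra. Qed.

Lemma glauber_step_le f g : (forall s, f s <= g s) ->
  forall s, glauber_step f s <= glauber_step g s.
Proof.
move=> fg s; rewrite !glauber_stepE; apply: ler_sum => i _.
apply: ler_wpM2l; first by rewrite invr_ge0 ltW.
by apply: lerD; apply: ler_wpM2l => //; [exact: site_prob_ge0|exact: site_prob_le1].
Qed.

Lemma sum_const_inv (a : R) : \sum_(i < n) n%:R^-1 * a = a.
Proof. by rewrite sumr_const card_ord -[LHS]mulr_natl; field; rewrite gt_eqF. Qed.

Lemma glauber_step_lin (a b c : R) f g s :
  glauber_step (fun x => a * f x + b * g x + c) s =
  a * glauber_step f s + b * glauber_step g s + c.
Proof.
rewrite !glauber_stepE !mulr_sumr -[X in _ + _ + X]sum_const_inv -!big_split /=.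
by apply: eq_bigr => i _; ring.
Qed.

Lemma glauber_step_ext f g : f =1 g -> glauber_step f =1 glauber_step g.
Proof. by move=> fg s; rewrite !glauber_stepE; apply: eq_bigr => i _; rewrite !fg. Qed.

Lemma iter_glauber_step_ext t f g : f =1 g ->
  iter t glauber_step f =1 iter t glauber_step g.
Proof. by move=> fg; elim: t => [//|t IH] /=; exact: glauber_step_ext. Qed.

Lemma iter_glauber_step_le t f g : (forall s, f s <= g s) ->
  forall s, iter t glauber_step f s <= iter t glauber_step g s.
Proof. by move=> fg; elim: t => [//|t IH] s /=; exact: glauber_step_le. Qed.

Lemma iter_glauber_step_lin t (a b c : R) f g s :
  iter t glauber_step (fun x => a * f x + b * g x + c) s =
  a * iter t glauber_step f s + b * iter t glauber_step g s + c.
Proof.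
elim: t s => [//|t IH] s /=.
by rewrite -glauber_step_lin; exact: glauber_step_ext.
Qed.

(** The update probability depends on the configuration only through the count and the spin at the
    site, so the count is itself a Markov chain. In the proof [A] is the contribution of a plus site
    and [B] that of a minus site. *)
Lemma glauber_step_count (h : nat -> R) s :
  glauber_step (h \o plus_count) s = count_step n h (plus_count s).
Proof.
rewrite glauber_stepE /=.
pose k := plus_count s.
pose A := plus_prob R n k.-1 * h k + (1 - plus_prob R n k.-1) * h k.-1.
pose B := plus_prob R n k * h k.+1 + (1 - plus_prob R n k) * h k.
rewrite (eq_bigr (fun i => n%:R^-1 * ((s i)%:R * (A - B)) + n%:R^-1 * B)); last first.
  move=> i _; rewrite site_probE -mulrDr; congr (_ * _).
  have := plus_count_set s i true; have := plus_count_set s i false.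
  rewrite -/k /A /B; case si : (s i) => /= e0 e1.
    have -> : plus_count (set_spin s i true) = k by lia.
    have -> : plus_count (set_spin s i false) = k.-1 by lia.
    ring.
  have -> : plus_count (set_spin s i true) = k.+1 by lia.
  have -> : plus_count (set_spin s i false) = k by lia.
  ring.
rewrite big_split /= sum_const_inv -mulr_sumr -mulr_suml -natr_sum -/(plus_count s) -/k.
rewrite /A /B /count_step /rate_up /rate_down; ring.
Qed.

Lemma iter_glauber_step_count t (h : nat -> R) s :
  iter t glauber_step (h \o plus_count) s = iter t (@count_step R n) h (plus_count s).
Proof.
elim: t s => [//|t IH] s /=.
by rewrite -glauber_step_count; exact: glauber_step_ext.
Qed.

End Configurations.

(** * Near exchangeability *)

Section Exchangeability.
Variables (R : realType) (n : nat).
Hypothesis n_gt0 : (0 < n)%N.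
Implicit Types (s : config n) (i j k : 'I_n) (f g : config n -> R).

Local Notation P := (@glauber_step R n).

Definition swap i j s : config n := [ffun k => s (tperm i j k)].

Lemma swapE i j s k : swap i j s k = s (tperm i j k).
Proof. by rewrite ffunE. Qed.

Lemma swap_id i j s : s i = s j -> swap i j s = s.
Proof.
by move=> sij; apply/ffunP => k; rewrite swapE; case: tpermP => // ->.
Qed.

Lemma plus_count_swap i j s : plus_count (swap i j s) = plus_count s.
Proof.
rewrite /plus_count [RHS](reindex_inj (@perm_inj _ (tperm i j))) /=.
by apply: eq_bigr => k _; rewrite swapE.
Qed.

Lemma site_prob_swap i j s k :
  site_prob R (swap i j s) k = site_prob R s (tperm i j k).
Proof. by rewrite !site_probE // plus_count_swap swapE. Qed.

Lemma set_spin_swap i j s k b :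
  set_spin (swap i j s) k b = swap i j (set_spin s (tperm i j k) b).
Proof.
by apply/ffunP => l; rewrite !(set_spinE, swapE) (inj_eq perm_inj).
Qed.

Lemma glauber_step_swap f i j s : P f (swap i j s) = P (f \o swap i j) s.
Proof.
rewrite !glauber_stepE [RHS](reindex_inj (@perm_inj _ (tperm i j))) /=.
by apply: eq_bigr => k _; rewrite site_prob_swap !set_spin_swap.
Qed.

(** An update at [i], chosen with probability 1/n, copies the spin of [j] with probability at least
    1/24; every other site is bounded trivially by 1. *)
Lemma glauber_step_disagree i j s : i != j -> s i != s j ->
  P (fun x => (x i != x j)%:R) s <= 1 - (24 * n%:R)^-1.
Proof.
move=> ij sij; rewrite glauber_stepE.
have nn : 0 < n%:R :> R by rewrite ltr0n.
rewrite -[leRHS](@sum_const_inv R n n_gt0).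
rewrite (bigD1 i) //= [leRHS](bigD1 i) //=.
have tot : n%:R^-1 * (1 - (24 * n%:R)^-1) +
    \sum_(k < n | k != i) n%:R^-1 * (1 - (24 * n%:R)^-1) =
    n%:R^-1 * (1 - 24^-1) + \sum_(k < n | k != i) n%:R^-1 :> R.
  have := @sum_const_inv R n n_gt0 (1 - (24 * n%:R)^-1).
  rewrite (bigD1 i) //= => ->.
  have h : n%:R^-1 + \sum_(k < n | k != i) n%:R^-1 = 1 :> R.
    have <- : \sum_(k < n) n%:R^-1 = n%:R^-1 + \sum_(k < n | k != i) n%:R^-1 :> R.
      by rewrite (bigD1 i).
    by rewrite sumr_const card_ord -[LHS]mulr_natl mulfV // gt_eqF.
  have -> : \sum_(k < n | k != i) n%:R^-1 = 1 - n%:R^-1 :> R.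
    by apply/eqP; rewrite eq_sym subr_eq addrC h.
  by field; rewrite gt_eqF.
rewrite {}tot; apply: lerD.
  apply: ler_wpM2l; first by rewrite invr_ge0 ltW.
  have := @site_prob_bounds R n n_gt0 s i.
  rewrite !set_spinE eqxx [j == i]eq_sym (negbTE ij).
  by case: (s j) => /=; lra.
apply: ler_sum => k _; rewrite -[leRHS]mulr1.
apply: ler_wpM2l; first by rewrite invr_ge0 ltW.
have := @site_prob_bounds R n n_gt0 s k.
have b01 (b : bool) : 0 <= (b%:R : R) <= 1 by case: b; rewrite ?lexx ?ler01.
move=> p; have := b01 (set_spin s k true i != set_spin s k true j).
have := b01 (set_spin s k false i != set_spin s k false j).
move: (_%:R) (_%:R) => x y; nra.
Qed.

(** A chain and its swapped image coincide as soon as the spins at [i] and [j] agree. Keeping the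
    indicator of disagreement in the bound makes the induction work. *)
Lemma iter_glauber_step_swap g t i j s : (forall x, 0 <= g x <= 1) ->
  `|iter t P g s - iter t P g (swap i j s)| <=
    (1 - (24 * n%:R)^-1) ^+ t * (s i != s j)%:R.
Proof.
move=> g01; set r := 1 - _.
have nn : 1 <= n%:R :> R by rewrite ler1n.
have r0 : 0 <= r.
  by rewrite subr_ge0 invf_le1; lra.
elim: t s => [|t IH] s.
  case: eqP => [sij|_] /=; first by rewrite swap_id // subrr normr0 mulr0.
  rewrite mul1r ler_norml; have := g01 s; have := g01 (swap i j s); lra.
case: (eqVneq (s i) (s j)) => [sij|sij].
  by rewrite swap_id // subrr normr0 mulr0.
have ij : i != j by apply: contraNneq sij => ->.
rewrite mulr1 /= glauber_step_swap.
set F := iter t P g.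
have -> : P F s - P (F \o swap i j) s =
    P (fun x => 1 * F x + (-1) * F (swap i j x) + 0) s.
  by rewrite glauber_step_lin //; rewrite mul1r addr0 mulN1r.
rewrite exprSr; set D := fun x : config n => (x i != x j)%:R : R.
have h := glauber_step_disagree ij sij; rewrite -/r in h.
have {}IH x : `|F x - F (swap i j x)| <= r ^+ t * D x := IH x.
have up : P (fun x => 1 * F x + (-1) * F (swap i j x) + 0) s <=
    P (fun x => r ^+ t * D x + 0 * D x + 0) s.
  apply: glauber_step_le => // x; have := IH x.
  by rewrite ler_norml; lra.
have dn : P (fun x => (- r ^+ t) * D x + 0 * D x + 0) s <=
    P (fun x => 1 * F x + (-1) * F (swap i j x) + 0) s.
  apply: glauber_step_le => // x; have := IH x.
  by rewrite ler_norml; lra.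
move: up dn; move: (P (fun x => 1 * F x + _ + _) s) => Q.
rewrite !glauber_step_lin // => up dn.
have := ler_wpM2l (exprn_ge0 t r0) h.
by rewrite ler_norml; lra.
Qed.

(** Otherwise [s] lies below [s'] sitewise, and equal sums force equality. *)
Lemma exists_swap_pair s s' : plus_count s = plus_count s' -> s != s' ->
  exists i, s i && ~~ s' i.
Proof.
move=> ss' ne; apply/existsP; apply: contraNT ne => /existsPn h.
apply/eqP/ffunP => i.
have le k : (true -> nat_of_bool (s k) <= nat_of_bool (s' k) ?= iff (s k == s' k))%N.
  by move=> _; have := h k; case: (s k); case: (s' k).
have /leqif_sum := le => -[_ /esym].
rewrite -/(plus_count s) -/(plus_count s') ss' eqxx.
by move=> /forallP /(_ i) /eqP.
Qed.

(** Swapping a site where only [x] is plus with one where only [s'] is plus shrinks the set of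
    disagreements, so at most n swaps lead from one configuration to the other. *)
Lemma near_exchangeable (F : config n -> R) (e : R) : 0 <= e ->
  (forall i j s, `|F s - F (swap i j s)| <= e) ->
  forall s s', plus_count s = plus_count s' -> `|F s - F s'| <= n%:R * e.
Proof.
move=> e0 Fe s s' ss'.
suff main m (x : config n) : (#|[set i | x i != s' i]| <= m)%N ->
    plus_count x = plus_count s' -> `|F x - F s'| <= m%:R * e.
  by apply: main => //; rewrite -[leqRHS]card_ord max_card.
elim: m x => [|m IH] x.
  rewrite leqn0 cards_eq0 => /eqP h _.
  suff -> : x = s' by rewrite subrr normr0 mul0r.
  apply/ffunP => i; apply/eqP; apply: contraT => xi.
  have : i \in [set k | x k != s' k] by rewrite inE.
  by rewrite h inE.
move=> xm xs; case: (eqVneq x s') => [->|ne].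
  by rewrite subrr normr0 mulr_ge0.
have [i /andP[xi s'i]] := exists_swap_pair xs ne.
rewrite eq_sym in ne; have [j /andP[s'j xj]] := exists_swap_pair (esym xs) ne.
have h : `|F (swap i j x) - F s'| <= m%:R * e.
  apply: IH; last by rewrite plus_count_swap.
  rewrite -ltnS; apply: leq_trans xm; apply: proper_card.
  apply/properP; split.
    apply/fintype.subsetP => k; rewrite !inE swapE.
    by case: tpermP => [->|->|//]; [rewrite (negbTE xj) (negbTE s'i)|rewrite xi s'j].
  exists i; rewrite !inE ?swapE ?tpermL; first by rewrite xi (negbTE s'i).
  by rewrite (negbTE xj) (negbTE s'i).
have -> : F x - F s' = (F x - F (swap i j x)) + (F (swap i j x) - F s') by ring.
apply: le_trans (ler_normD _ _) _; rewrite -natr1 mulrDl mul1r addrC.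
exact: lerD.
Qed.

End Exchangeability.

(** * Stationarity and symmetry of the Ising measure *)

Section IsingMeasure.
Variables (R : realType) (n : nat).
Hypothesis n_gt0 : (0 < n)%N.
Implicit Types (s : config n) (i j k : 'I_n) (f g : config n -> R).

Local Notation P := (@glauber_step R n).
Local Notation mu := (@ising R 1 n).
Local Notation weight := (@gibbs_weight R 1 n).

Let size_gt0 : 0 < n%:R :> R. Proof. by rewrite ltr0n. Qed.

Lemma partition_function_gt0 : 0 < partition_function 1 n :> R.
Proof.
rewrite /partition_function (bigD1 [ffun=> true]) //=.
by apply: ltr_pwDl; rewrite ?expR_gt0 // sumr_ge0 // => s _; exact: expR_ge0.
Qed.

Lemma ising_ge0 s : 0 <= mu s.
Proof. by rewrite divr_ge0 ?expR_ge0 // ltW // partition_function_gt0. Qed.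

Lemma sum_ising : \sum_s mu s = 1.
Proof. by rewrite -mulr_suml divff // gt_eqF // partition_function_gt0. Qed.

Lemma pair_sum_sqr (x : 'I_n -> R) :
  2 * (\sum_(i < n) \sum_(j < n | (i < j)%N) x i * x j) =
  (\sum_(i < n) x i) ^+ 2 - \sum_(i < n) x i ^+ 2.
Proof.
rewrite expr2 mulr_suml.
have -> : \sum_(i < n) x i * (\sum_(j < n) x j) =
    \sum_(i < n) (\sum_(j < n | (i < j)%N) x i * x j + x i ^+ 2 +
                  \sum_(j < n | (j < i)%N) x i * x j).
  apply: eq_bigr => i _; rewrite mulr_sumr (bigID (fun j : 'I_n => (i < j)%N)) /=.
  rewrite -addrA; congr (_ + _).
  rewrite (bigD1 i) ?ltnn //= expr2; congr (_ + _).
  by apply: eq_bigl => j; rewrite -leqNgt ltn_neqAle andbC.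
rewrite !big_split /=.
have -> : \sum_(i < n) \sum_(j < n | (j < i)%N) x i * x j =
    \sum_(i < n) \sum_(j < n | (i < j)%N) x i * x j.
  rewrite (exchange_big_dep predT) //=; apply: eq_bigr => i _.
  by apply: eq_bigr => j _; rewrite mulrC.
ring.
Qed.

Lemma gibbs_weightE s :
  weight s = expR (((2 * (plus_count s)%:R - n%:R) ^+ 2 - n%:R) / (2 * n%:R)).
Proof.
rewrite /gibbs_weight; congr expR.
have := pair_sum_sqr (spin R s); rewrite sum_spin.
have -> : \sum_(i < n) spin R s i ^+ 2 = n%:R.
  rewrite (eq_bigr (fun=> 1)); first by rewrite sumr_const card_ord.
  by move=> i _; rewrite spinE; case: (s i) => /=; ring.
by move=> <-; field; rewrite gt_eqF.
Qed.

Definition flip i s : config n := set_spin s i (~~ s i).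

Lemma flipK i : involutive (flip i).
Proof.
move=> s; rewrite /flip set_spinK set_spinE eqxx negbK; exact: set_spin_id.
Qed.

Lemma site_prob_set s i b : site_prob R (set_spin s i b) i = site_prob R s i.
Proof.
rewrite !site_probE // set_spinE eqxx; congr plus_prob.
have := plus_count_set s i b; case si : (s i) => /=.
  by have := plus_count_gt0 si; case: b => /=; lia.
by case: b => /=; lia.
Qed.

(** Detailed balance at one site: the odds of plus and the ratio of the two weights both equal the
    exponential of 2x, x being the field of the other spins. *)
Lemma site_prob_weight s i :
  site_prob R s i * weight (set_spin s i false) =
  (1 - site_prob R s i) * weight (set_spin s i true).
Proof.
rewrite -(site_prob_set s i false) site_probE // set_spinE eqxx.
set k := plus_count (set_spin s i false).
have ek : plus_count (set_spin s i true) = k.+1.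
  have := plus_count_set s i true; have := plus_count_set s i false.
  by rewrite -/k; lia.
rewrite !gibbs_weightE ek -/k /plus_prob /p_plus mul1r.
set x := (2 * k%:R + 1) / n%:R - 1.
have -> : ((2 * k.+1%:R - n%:R) ^+ 2 - n%:R) / (2 * n%:R) =
    ((2 * k%:R - n%:R) ^+ 2 - n%:R) / (2 * n%:R) + x + x.
  by rewrite /x -natr1; field; rewrite gt_eqF.
move: (_ / (2 * n%:R)) x => y x; rewrite !expRD; move: (expR y) => W.
have ex := expR_gt0 x.
rewrite /tanh expRN; move: (expR x) ex => e e0.
by field; rewrite !gt_eqF // addr_gt0 // mulr_gt0.
Qed.

Lemma ising_stationary f : \sum_s mu s * P f s = \sum_s mu s * f s.
Proof.
under eq_bigr do rewrite /ising mulrAC.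
under [RHS]eq_bigr do rewrite /ising mulrAC.
rewrite -!mulr_suml; congr (_ / _).
pose br i s := site_prob R s i * f (set_spin s i true) +
               (1 - site_prob R s i) * f (set_spin s i false).
have site i : \sum_s weight s * br i s = \sum_s weight s * f s.
  (* Doubling the sum lets each configuration be paired with its flip at [i]; on such a pair [br i]
     is constant and detailed balance gives the equality. *)
  apply: (@mulrI _ 2); first by rewrite unitfE.
  rewrite !mulrDl !mul1r.
  rewrite {2}(reindex_inj (inv_inj (flipK i))).
  rewrite [X in _ = _ + X](reindex_inj (inv_inj (flipK i))).
  rewrite -!big_split /=; apply: eq_bigr => s _.
  have -> : br i (flip i s) = br i s.
    by rewrite /br /flip site_prob_set !set_spinK.
  rewrite /br; have := site_prob_weight s i.
  set wt := weight (set_spin s i true); set wf := weight (set_spin s i false).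
  set ft := f (set_spin s i true); set ff := f (set_spin s i false).
  move: (site_prob R s i) => p hp.
  rewrite -mulrDl.
  have [-> ->] : weight s + weight (flip i s) = wt + wf /\
      weight s * f s + weight (flip i s) * f (flip i s) = wt * ft + wf * ff.
    rewrite /wt /wf /ft /ff /flip.
    by have := set_spin_id s i; case: (s i) => /= ->; split; rewrite // addrC.
  have -> : (wt + wf) * (p * ft + (1 - p) * ff) =
      wt * ft + wf * ff + (ft - ff) * (p * wf - (1 - p) * wt) by ring.
  by rewrite hp subrr mulr0 addr0.
under eq_bigr => s _.
  rewrite glauber_stepE mulr_sumr.
  over.
rewrite exchange_big /=.
rewrite (eq_bigr (fun=> n%:R^-1 * \sum_s weight s * f s)) ?sum_const_inv //.
move=> i _; rewrite -(site i) mulr_sumr; apply: eq_bigr => s _.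
by rewrite /br mulrCA.
Qed.

Lemma iter_ising_stationary t f :
  \sum_s mu s * iter t P f s = \sum_s mu s * f s.
Proof. by elim: t => [//|t IH]; rewrite /= ising_stationary. Qed.

Definition neg_config s : config n := [ffun i => ~~ s i].

Lemma neg_configK : involutive neg_config.
Proof. by move=> s; apply/ffunP => i; rewrite !ffunE negbK. Qed.

Lemma ising_neg s : mu (neg_config s) = mu s.
Proof.
rewrite /ising /gibbs_weight; congr (expR (_ * _) / _).
apply: eq_bigr => i _; apply: eq_bigr => j _.
by rewrite /spin !ffunE; case: (s i); case: (s j) => /=; ring.
Qed.

Lemma plus_count_neg s : (plus_count (neg_config s) + plus_count s = n)%N.
Proof.
rewrite /plus_count -big_split /= -[RHS]muln1 -[X in (X * 1)%N]card_ord.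
by rewrite -sum_nat_const; apply: eq_bigr => i _; rewrite ffunE; case: (s i).
Qed.

(** The global spin flip preserves the measure and maps a strict plus majority into its
    complement. *)
Lemma ising_majority_le : \sum_(s in [set s | (n < 2 * plus_count s)%N]) mu s <= 1 / 2.
Proof.
set A := [set s | _]; have := sum_ising.
rewrite (bigID (mem A)) /=.
have : \sum_(s in A) mu s <= \sum_(s | s \notin A) mu s.
  rewrite (reindex_inj (inv_inj neg_configK)) /=.
  rewrite [leRHS](bigID (fun s => neg_config s \in A)) /=.
  rewrite (eq_bigl (fun s => (s \notin A) && (neg_config s \in A))).
    rewrite (eq_bigr mu) => [|s _]; last exact: ising_neg.
    by rewrite lerDl sumr_ge0 // => s _; exact: ising_ge0.
  move=> s; rewrite !inE; have := plus_count_neg s; lia.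
lra.
Qed.

End IsingMeasure.

(** * The mixing time *)

Section MixingTime.
Variable R : realType.
Implicit Types (n t : nat).

Definition indic n (A : {set config n}) (s : config n) : R := (s \in A)%:R.

Lemma indic_itv n (A : {set config n}) s : 0 <= indic A s <= 1.
Proof. by rewrite /indic; case: (_ \in _); rewrite ?lexx ?ler01. Qed.

Lemma sum_indic n (A : {set config n}) (f : config n -> R) :
  \sum_(s in A) f s = \sum_s f s * indic A s.
Proof.
rewrite big_mkcond /=; apply: eq_bigr => s _; rewrite /indic.
by case: (_ \in _); rewrite ?mulr1 ?mulr0.
Qed.

Lemma mixing_distance_ge n t (A : {set config n}) s :
  `|iter t (@glauber_step R n) (indic A) s - \sum_(x in A) ising 1 x| <=
    mixing_distance (1 : R) n t.
Proof.
rewrite -sum_law -sum_indic /mixing_distance /tv_dist.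
apply: (bigmax_sup s) => //.
exact: (le_bigmax _ (fun A0 : {set config n} =>
  `|\sum_(x in A0) law (@glauber R 1 n) s t x - \sum_(x in A0) ising 1 x|)).
Qed.

(** By stationarity the Ising mass of an event is the Ising average of its probability at time [t],
    so the oscillation over starting points bounds the distance. *)
Lemma mixing_distance_le n t (e : R) : (0 < n)%N -> 0 <= e ->
  (forall g : config n -> R, (forall s, 0 <= g s <= 1) -> forall s s',
    `|iter t (@glauber_step R n) g s - iter t (@glauber_step R n) g s'| <= e) ->
  mixing_distance (1 : R) n t <= e.
Proof.
move=> n0 e0 osc; apply: bigmax_le => // s _; apply: bigmax_le => // A _.
rewrite !sum_indic sum_law -(iter_ising_stationary n0 t).
set h := iter t _ _; have -> : h s - \sum_x ising 1 x * h x =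
    \sum_x ising 1 x * (h s - h x).
  under [RHS]eq_bigr do rewrite mulrBr.
  by rewrite sumrB -mulr_suml sum_ising mul1r.
apply: le_trans (ler_norm_sum _ _ _) _.
have -> : e = \sum_(x : config n) ising 1 x * e.
  by rewrite -mulr_suml sum_ising mul1r.
apply: ler_sum => x _.
rewrite normrM (ger0_norm (ising_ge0 R x)); apply: ler_wpM2l.
  exact: ising_ge0.
by apply: osc; exact: indic_itv.
Qed.

(** A polynomial substitute for exponential decay; the induction step only drops a multiple of
    [y ^+ 2]. *)
Lemma exp_onem_le (y : R) t : 0 <= y <= 1 -> (1 - y) ^+ t * (1 + t%:R * y) <= 1.
Proof.
move=> /andP[y0 y1]; elim: t => [|t IH]; first by rewrite mul0r addr0 mulr1.
rewrite exprSr -mulrA; apply: le_trans IH.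
apply: ler_wpM2l; first by rewrite exprn_ge0 // subr_ge0.
have ty : 0 <= t%:R * (y * y) by rewrite !mulr_ge0.
by rewrite -natr1; have := mulr_ge0 y0 y0; lra.
Qed.

(** Applied to 96 m steps, [exp_onem_le] gives q <= n / (4m). Doubling the time squares this, and
    n^3 <= m^2 yields q^2 <= 1 / (16n), which beats the n swaps. *)
Lemma near_exchangeable_time n m (g : config n -> R) : (0 < n)%N ->
  (n ^ 3 <= m ^ 2)%N -> (forall s, 0 <= g s <= 1) ->
  forall s s', plus_count s = plus_count s' ->
    `|iter (2 * (96 * m)) (@glauber_step R n) g s -
      iter (2 * (96 * m)) (@glauber_step R n) g s'| <= 1 / 16.
Proof.
move=> n0 nm g01 s s' ss'; have nn : 1 <= n%:R :> R by rewrite ler1n.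
set T := (2 * (96 * m))%N; set y : R := (24 * n%:R)^-1.
have y01 : 0 <= y <= 1 by rewrite invr_ge0 invf_le1; lra.
have r0 : 0 <= 1 - y by lra.
apply: le_trans (near_exchangeable (exprn_ge0 T r0) _ ss') _.
  move=> i j x; apply: le_trans (iter_glauber_step_swap n0 T i j x g01) _.
  by rewrite ler_piMr ?exprn_ge0 //; case: (_ != _); rewrite ?lexx ?ler01.
rewrite /T mulnC exprM; set q := (1 - y) ^+ (96 * m).
have q0 : 0 <= q by exact: exprn_ge0.
have hq : q * (4 * m%:R / n%:R) <= 1.
  apply: le_trans (exp_onem_le (96 * m) y01); apply: ler_wpM2l => //.
  have -> : (96 * m)%:R * y = 4 * m%:R / n%:R.
    by rewrite natrM /y; field; rewrite gt_eqF //; lra.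
  lra.
have hm : n%:R ^+ 3 <= m%:R ^+ 2 :> R by rewrite -!natrX ler_nat.
have hq2 : (q * (4 * m%:R / n%:R)) ^+ 2 <= 1.
  by rewrite expr_le1 // mulr_ge0 // divr_ge0 // mulr_ge0.
have e : (q * (4 * m%:R / n%:R)) ^+ 2 = 16 * (q ^+ 2 * (m%:R ^+ 2 / n%:R ^+ 2)).
  by field; rewrite gt_eqF //; lra.
have h : q ^+ 2 * n%:R <= q ^+ 2 * (m%:R ^+ 2 / n%:R ^+ 2).
  apply: ler_wpM2l; first exact: sqr_ge0.
  have n2 : 0 < n%:R ^+ 2 :> R by apply: exprn_gt0; lra.
  by rewrite ler_pdivlMr // -exprS.
rewrite e in hq2; lra.
Qed.

(** A representative for each count, turning a function of configurations into one of the count. *)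
Definition first_plus n k : config n := [ffun i : 'I_n => (i < k)%N].

Lemma plus_count_first n k : (k <= n)%N -> plus_count (first_plus n k) = k.
Proof.
move=> kn; rewrite /plus_count.
under eq_bigr do rewrite ffunE.
rewrite -(big_mkord xpredT (fun i => nat_of_bool (i < k)%N)).
rewrite (big_cat_nat _ (n := k)) //= big_nat (eq_bigr (fun=> 1%N)); last first.
  by move=> i /andP[_ ->].
rewrite -big_nat sum_nat_const_nat subn0 muln1.
rewrite big_nat big1 ?addn0 // => i /andP[ki _].
by rewrite ltnNge ki.
Qed.

(** Replacing [h] by its value at the representative costs [e1] at each of the two starting points;
    what remains is the count chain. *)
Lemma iter_glauber_osc n T (h : config n -> R) (e1 e2 : R) : (0 < n)%N ->
  (forall s s', plus_count s = plus_count s' -> `|h s - h s'| <= e1) ->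
  (forall k l, (k <= n)%N -> (l <= n)%N ->
    `|iter T (@count_step R n) (h \o first_plus n) k -
      iter T (@count_step R n) (h \o first_plus n) l| <= e2) ->
  forall s s', `|iter T (@glauber_step R n) h s - iter T (@glauber_step R n) h s'|
    <= 2 * e1 + e2.
Proof.
move=> n0 he hosc s s'; set H := h \o first_plus n.
have near x : `|iter T (@glauber_step R n) h x -
    iter T (@count_step R n) H (plus_count x)| <= e1.
  rewrite -iter_glauber_step_count //.
  have hn z : `|h z - (H \o @plus_count n) z| <= e1.
    by apply: he; rewrite plus_count_first // plus_count_le.
  have up := @iter_glauber_step_le R n n0 T h
    (fun z => 1 * (H \o @plus_count n) z + 0 * h z + e1).
  have lo := @iter_glauber_step_le R n n0 T
    (fun z => 1 * (H \o @plus_count n) z + 0 * h z + - e1) h.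
  rewrite ler_norml; apply/andP; split.
    have {}lo := lo _ x; rewrite iter_glauber_step_lin // in lo.
    suff /lo : forall z, 1 * (H \o @plus_count n) z + 0 * h z + - e1 <= h z by lra.
    by move=> z; have := hn z; rewrite ler_norml; lra.
  have {}up := up _ x; rewrite iter_glauber_step_lin // in up.
  suff /up : forall z, h z <= 1 * (H \o @plus_count n) z + 0 * h z + e1 by lra.
  by move=> z; have := hn z; rewrite ler_norml; lra.
have := near s; have := near s'.
have := hosc _ _ (plus_count_le s) (plus_count_le s').
by rewrite !ler_norml; lra.
Qed.

End MixingTime.

(** * Upper and lower bounds on the mixing time *)

Section Bounds.
Variable R : realType.
Implicit Types (n t : nat).

Lemma iter_glauber_step_itv n t (g : config n -> R) : (0 < n)%N ->
  (forall s, 0 <= g s <= 1) -> forall s, 0 <= iter t (@glauber_step R n) g s <= 1.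
Proof.
move=> n0 g01 s.
have cst c : iter t (@glauber_step R n) (fun=> c) s = c.
  have := @iter_glauber_step_lin R n n0 t 0 0 c (fun=> c) (fun=> c) s.
  rewrite !mul0r !add0r => e; rewrite -[RHS]e.
  by apply: iter_glauber_step_ext => z; ring.
apply/andP; split; [rewrite -[leLHS](cst 0)|rewrite -[leRHS](cst 1)];
  by apply: iter_glauber_step_le => // z; have /andP[] := g01 z.
Qed.

(** A crude bound valid for every size, meant for the finitely many small ones: the contraction 1 -
    1/n^2 alone, over 8 n^3 steps, makes the gradient at most 1 / (8n). *)
Lemma mixing_distance_small n : (0 < n)%N ->
  exists t, mixing_distance (1 : R) n t <= 1 / 4.
Proof.
move=> n0; have nn : 1 <= n%:R :> R by rewrite ler1n.
have np : 0 < n%:R :> R by lra.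
pose T := (8 * n ^ 3)%N; pose m := (n ^ 2)%N.
exists (T + 2 * (96 * m))%N; apply: mixing_distance_le => // g g01 s s'.
rewrite iterD; set h := iter (2 * (96 * m)) _ g.
have nm : (n ^ 3 <= m ^ 2)%N by rewrite /m -expnM leq_pexp2l.
have -> : 1 / 4 = 2 * (1 / 16) + 1 / 8 :> R by lra.
apply: iter_glauber_osc => // [|k l kn ln].
  exact: near_exchangeable_time.
set H := h \o first_plus n.
have Hu j : 0 <= H j <= 1 by exact: iter_glauber_step_itv.
have dH j : (j < n)%N -> `|H j.+1 - H j| <= 1.
  by move=> _; have := Hu j; have := Hu j.+1; rewrite ler_norml; lra.
have hd := iter_grad_contraction n0 T ler01 dH.
apply: le_trans (grad_bound_osc n0 hd kn ln) _.
set q := (1 - n%:R^-1 ^+ 2) ^+ T * 1.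
have y01 : 0 <= (n%:R^-1 ^+ 2 : R) <= 1.
  by rewrite sqr_ge0 expr_le1 ?invr_ge0 // invf_le1.
have q0 : 0 <= q by rewrite /q mulr1 exprn_ge0 // subr_ge0; case/andP: y01.
have hq : q * (8 * n%:R) <= 1.
  rewrite /q mulr1; apply: le_trans (exp_onem_le T y01).
  apply: ler_wpM2l; first by rewrite exprn_ge0 // subr_ge0; case/andP: y01.
  have -> : T%:R * n%:R^-1 ^+ 2 = 8 * n%:R :> R.
    by rewrite /T natrM natrX; field; rewrite gt_eqF.
  lra.
have hs : `|spin_mean R n k - spin_mean R n l| <= 2.
  have := spin_mean_bounds R n0 kn; have := spin_mean_bounds R n0 ln.
  by rewrite ler_norml; lra.
have : q * (n%:R / 2) * `|spin_mean R n k - spin_mean R n l| <= q * (n%:R / 2) * 2.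
  by apply: ler_wpM2l => //; rewrite mulr_ge0 // divr_ge0.
lra.
Qed.

Lemma mixing_distance_upper : exists M N0 : nat, forall n m (w : R),
  (N0 <= n)%N -> (0 < n)%N -> 1 <= w -> w ^+ 4 = n%:R ->
  w ^+ 6 <= m%:R <= 2 * w ^+ 6 ->
  mixing_distance (1 : R) n (M * m) <= 1 / 4.
Proof.
have [M [N0 hM]] := count_chain_mixes R.
exists (1 + M ^ 2 + 192)%N, N0 => n m w nN n0 w1 wn mw.
have -> : ((1 + M ^ 2 + 192) * m = (m + M ^ 2 * m) + 2 * (96 * m))%N by lia.
apply: mixing_distance_le => // g g01 s s'.
rewrite iterD; set h := iter (2 * (96 * m)) _ g.
have nm : (n ^ 3 <= m ^ 2)%N.
  rewrite -(ler_nat R) !natrX -wn -exprM.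
  have -> : w ^+ (4 * 3) = (w ^+ 6) ^+ 2 by rewrite -exprM.
  case/andP: mw => mw _; rewrite lerXn2r ?nnegrE // exprn_ge0 //; lra.
have -> : 1 / 4 = 2 * (1 / 16) + 1 / 8 :> R by lra.
apply: iter_glauber_osc => // [|k l kn ln].
  exact: near_exchangeable_time.
by apply: (hM n m w) => // j jn; exact: iter_glauber_step_itv.
Qed.

(** Take the least [k] reaching 1/w: it overshoots by at most one step, 2/n <= 2/w. *)
Lemma exists_spin_mean_near n (w : R) : (0 < n)%N -> 1 <= w -> w ^+ 4 = n%:R ->
  exists2 k, (k <= n)%N & w^-1 <= spin_mean R n k <= 3 * w^-1.
Proof.
move=> n0 w1 wn; have nn : 0 < n%:R :> R by rewrite ltr0n.
have w0 : 0 < w by lra.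
have wi : w^-1 <= 1 by rewrite invf_le1.
have wip : 0 < w^-1 by rewrite invr_gt0.
have sn : w^-1 <= spin_mean R n n.
  by rewrite /spin_mean mulfK ?gt_eqF //; lra.
have ex : exists k, w^-1 <= spin_mean R n k by exists n.
case: (ex_minnP ex) => k hk kmin; exists k; first exact: kmin.
rewrite hk /=; case: k hk kmin => [|k] hk kmin.
  by move: hk; rewrite /spin_mean mulr0 mul0r; lra.
have : spin_mean R n k < w^-1.
  by rewrite ltNge; apply/negP => /kmin; rewrite ltnn.
have -> : spin_mean R n k.+1 = spin_mean R n k + 2 * n%:R^-1.
  by rewrite /spin_mean -natr1; ring.
have : n%:R^-1 <= w^-1.
  rewrite lef_pV2 ?posrE // -wn exprS ler_peMr ?exprn_ege1 //; lra.
lra.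
Qed.

(** Chebyshev's inequality for the event of a plus majority. At distance at most 1/4 its probability
    is at most 3/4, so the mean of w^2 V is at least 1/4; it is also at most 170 t / w^6, and 680 =
    4 * 170. *)
Lemma mixing_distance_lower n t (w : R) : (0 < n)%N -> 1 <= w ->
  w ^+ 4 = n%:R -> mixing_distance (1 : R) n t <= 1 / 4 ->
  680^-1 * w ^+ 6 <= t%:R.
Proof.
move=> n0 w1 wn hd; have nn : 0 < n%:R :> R by rewrite ltr0n.
have w0 : 0 < w by lra.
have [k kn /andP[k1 k2]] := exists_spin_mean_near n0 w1 wn.
set c := spin_mean R n k in k1 k2.
have wi : 0 < w^-1 by rewrite invr_gt0.
have c01 : 0 <= c <= 1.
  by have := spin_mean_bounds R n0 kn; rewrite -/c; lra.
pose V j := (spin_mean R n j - c) ^+ 2.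
have hV : iter t (@count_step R n) V k <= t%:R * (170 / w ^+ 8).
  apply: le_trans (iter_count_step_sqr_dist t n0 kn c01) _.
  rewrite subrr expr0n /= add0r; apply: ler_wpM2l => //.
  have c4 : c ^+ 4 <= 81 / w ^+ 4.
    have -> : 81 / w ^+ 4 = (3 * w^-1) ^+ 4 by field; rewrite gt_eqF.
    by rewrite lerXn2r ?nnegrE //; lra.
  have -> : 170 / w ^+ 8 = 2 / n%:R * (81 / w ^+ 4) + 8 / n%:R ^+ 2.
    by rewrite -wn; field; rewrite gt_eqF.
  by rewrite lerD2r; apply: ler_wpM2l => //; rewrite divr_ge0.
pose A := [set s : config n | (n < 2 * plus_count s)%N].
(* Without a plus majority s <= 0 while c >= 1/w, so w^2 V is at least 1. *)
have ind s : (- w ^+ 2) * (V \o @plus_count n) s + 0 * (V \o @plus_count n) s + 1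
    <= indic R A s.
  rewrite mul0r addr0 mulNr /indic inE /=.
  have V0 : 0 <= V (plus_count s) by exact: sqr_ge0.
  have w2 : 0 <= w ^+ 2 by exact: sqr_ge0.
  have wV := mulr_ge0 w2 V0.
  case: ltnP => hs /=; first lra.
  have s0 : spin_mean R n (plus_count s) <= 0.
    rewrite /spin_mean subr_le0 ler_pdivrMr // mul1r -natrM ler_nat; exact: hs.
  have cs : w^-1 ^+ 2 <= V (plus_count s).
    rewrite /V -(sqrrN (_ - c)) opprB lerXn2r ?nnegrE //; lra.
  have := ler_wpM2l w2 cs.
  have -> : w ^+ 2 * w^-1 ^+ 2 = 1 by field; rewrite gt_eqF.
  lra.
have := @iter_glauber_step_le R n n0 t _ _ ind (first_plus n k).
rewrite iter_glauber_step_lin // iter_glauber_step_count // plus_count_first //.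
have := mixing_distance_ge R t A (first_plus n k).
have := ising_majority_le R n0; rewrite -/A ler_norml.
move: (\sum_(s in A) _) (iter t _ (indic R A) _) => a b h1 h2 h3.
have w2 : 0 <= w ^+ 2 by exact: sqr_ge0.
have := ler_wpM2l w2 hV.
have -> : w ^+ 2 * (t%:R * (170 / w ^+ 8)) = 170 * (t%:R / w ^+ 6).
  by field; rewrite gt_eqF.
move=> h4; have : 680^-1 <= t%:R / w ^+ 6 by lra.
by rewrite ler_pdivlMr // exprn_gt0.
Qed.

Lemma mixing_time_exists n t : mixing_distance (1 : R) n t <= 1 / 4 ->
  exists2 tmix, is_mixing_time (1 : R) n tmix & (tmix <= t)%N.
Proof.
move=> ht; have ex : exists u, mixing_distance (1 : R) n u <= 1 / 4 by exists t.
case: (ex_minnP ex) => u hu umin; exists u; last exact: umin.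
by split=> // v; exact: umin.
Qed.

Lemma mixing_distance_bounded_sizes (N0 : nat) : exists T : nat,
  forall n, (0 < n)%N -> (n < N0)%N ->
    exists2 t, (t <= T)%N & mixing_distance (1 : R) n t <= 1 / 4.
Proof.
elim: N0 => [|N0 [T hT]]; first by exists 0%N.
case: (posnP N0) => [->|N0_gt0].
  by exists 0%N => n n0; rewrite ltnS leqNgt n0.
have [t ht] := mixing_distance_small N0_gt0.
exists (maxn T t) => n n0; rewrite ltnS leq_eqVlt => /orP[/eqP ->|nN].
  by exists t => //; rewrite leq_maxr.
by have [u uT hu] := hT n n0 nN; exists u => //; rewrite leq_max uT.
Qed.

(** All scales become integer powers of w: n^(3/4) is w^3, n^(3/2) is w^6. *)
Lemma exists_fourth_root n : (0 < n)%N -> exists w : R,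
  [/\ 1 <= w, w ^+ 4 = n%:R & n%:R `^ (3 / 2) = w ^+ 6].
Proof.
move=> n0; set w := Num.sqrt (Num.sqrt n%:R) : R.
have w0 : 0 <= w by exact: sqrtr_ge0.
have wn : w ^+ 4 = n%:R.
  have -> : w ^+ 4 = (w ^+ 2) ^+ 2 by rewrite -exprM.
  by rewrite !sqr_sqrtr ?sqrtr_ge0.
exists w; split=> //.
  rewrite -(@ler_pXn2r _ 4) ?nnegrE // expr1n wn ler1n //.
rewrite -wn -powR_mulrn // -powRrM -[RHS]powR_mulrn //; congr (_ `^ _).
lra.
Qed.

End Bounds.

Theorem theorem2 (R : realType) :
  exists C1 C2 : R,
    [/\ 0 < C1, 0 < C2 &
      forall n : nat, (1 <= n)%N ->
        exists tmix : nat,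
          [/\ is_mixing_time (1 : R) n tmix,
              C1 * n%:R `^ (3 / 2) <= tmix%:R &
              tmix%:R <= C2 * n%:R `^ (3 / 2)]].
Proof.
have [M [N0 hM]] := mixing_distance_upper R.
have [T hT] := mixing_distance_bounded_sizes R N0.
(* In the upper constant, 2M serves the sizes from [N0] on, T the smaller ones (as w^6 >= 1), and 1
   makes it positive. *)
exists 680^-1, (2 * M%:R + T%:R + 1); split; first by rewrite invr_gt0 ltr0n.
  by rewrite ltr_wpDl // addr_ge0 // mulr_ge0.
move=> n n0; have [w [w1 wn ->]] := exists_fourth_root R n0.
have w6 : 1 <= w ^+ 6 by exact: exprn_ege1.
have [t ht hd] : exists2 t : nat, t%:R <= (2 * M%:R + T%:R + 1) * w ^+ 6 &
    mixing_distance (1 : R) n t <= 1 / 4.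
  have TM0 : 0 <= T%:R * w ^+ 6 :> R by rewrite mulr_ge0 //; lra.
  have MM0 : 0 <= M%:R * w ^+ 6 :> R by rewrite mulr_ge0 //; lra.
  case: (ltnP n N0) => nN.
    have [t tT hd] := hT n n0 nN; exists t => //.
    have : t%:R <= T%:R :> R by rewrite ler_nat.
    have : T%:R * 1 <= T%:R * w ^+ 6 by apply: ler_wpM2l.
    lra.
  have w60 : 0 <= w ^+ 6 by lra.
  have /andP[m1 m2] := truncn_itv w60.
  (* Rounding up keeps [m] at most w^6 + 1 <= 2 w^6. *)
  pose m := (Num.truncn (w ^+ 6)).+1.
  have mw : w ^+ 6 <= m%:R <= 2 * w ^+ 6.
    by rewrite (ltW m2) /m -natr1; lra.
  exists (M * m)%N; last exact: (hM n m w).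
  case/andP: mw => _ mw; rewrite natrM.
  have : M%:R * m%:R <= M%:R * (2 * w ^+ 6) by apply: ler_wpM2l.
  lra.
have [u hu ut] := mixing_time_exists hd.
exists u; split=> //; first exact: (mixing_distance_lower n0 w1 wn hu.1).
by apply: le_trans ht; rewrite ler_nat.
Qed.
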